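(* The operators $\widetilde{B}_n$ and $\widehat{B}_n$ are saturated with the saturation rate of $1/n$. Their saturation class (the same for both) consists of those functions $f\in AC[0,1]$ such that $f(0),f(1)\in\mathbb{Z}$, $f'\in AC_{loc}(0,1)$ and $\varphi^2 f''\in L_\infty[0,1]$.
   Context: $\mathbb{N}_+=\{1,2,\dots\}$; $\|\cdot\|$ is the sup-norm on $[0,1]$; $\varphi(x):=\sqrt{x(1-x)}$. $AC[0,1]$ is the set of absolutely continuous real functions on $[0,1]$, and $AC_{loc}(0,1)$ is the set of functions on $(0,1)$ that are absolutely continuous on every compact subinterval of $(0,1)$. For $f\in C[0,1]$, $x\in[0,1]$ and $n\in\mathbb{N}_+$ define \[ \widetilde{B}_n(f)(x):=\sum_{k=0}^n \left[f\left(\tfrac{k}{n}\right)\binom{n}{k}\right]x^k(1-x)^{n-k},\qquad \widehat{B}_n(f)(x):=\sum_{k=0}^n \left\langle f\left(\tfrac{k}{n}\right)\binom{n}{k}\right\rangle x^k(1-x)^{n-k}, \] where $[a]$ is the largest integer less than or equal to the real $a$, and $\langle a\rangle$ is the nearest integer to $a$; if $a=m+1/2$ with $m\in\mathbb{Z}$, then $\langle a\rangle$ is set to be either $m$ or $m+1$ (the choice may depend on whether $m$ is positive or negative, even or odd), and the result holds regardless of the choice made. Saturation terminology, for a sequence of operators $L_n$ on $C[0,1]$ ($L_n=\widetilde B_n$ or $L_n=\widehat B_n$): $L_n$ is saturated with the saturation rate $1/n$ if every $f\in C[0,1]$ with $\|L_n(f)-f\|=o(1/n)$ satisfies $L_n(f)=f$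 for all $n$ (such functions form the trivial class), and there exists $f\in C[0,1]$ outside the trivial class with $\|L_n(f)-f\|=O(1/n)$. The saturation class is the set of all $f\in C[0,1]$ with $\|L_n(f)-f\|=O(1/n)$ as $n\to\infty$ (the implicit constant may depend on $f$). *)

(* Defs.v *)
From HB Require Import structures.
From mathcomp Require Import all_boot all_order all_algebra.
From mathcomp Require Import all_classical all_reals all_analysis.
Import Order.TTheory GRing.Theory Num.Theory.
Import numFieldNormedType.Exports.

Set Implicit Arguments.
Unset Strict Implicit.
Unset Printing Implicit Defensive.

Local Open Scope classical_set_scope.
Local Open Scope ring_scope.

(* A function on [0, 1] is represented by a total function R -> R of which
   only the values on [0, 1] matter. *)
Definition C01 (R : realType) : set (R -> R) :=
  [set f : R -> R | {within `[0, 1], continuous f}].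

Definition supnorm (R : realType) (f : R -> R) : R :=
  sup [set `|f x| | x in `[0, 1]%classic].

Definition phi (R : realType) (x : R) : R := Num.sqrt (x * (1 - x)).

Definition rounded_bernstein (R : realType) (r : R -> int)
    (n : nat) (f : R -> R) (x : R) : R :=
  \sum_(k < n.+1) (r (f (k%:R / n%:R) * 'C(n, k)%:R))%:~R
                  * x ^+ k * (1 - x) ^+ (n - k).

Definition bernstein_floor (R : realType) : nat -> (R -> R) -> R -> R :=
  rounded_bernstein (@Num.floor R).

(* Both neighbours are allowed at half-integers. *)
Definition nearest_integer (R : realType) (r : R -> int) : Prop :=
  forall a : R, `|a - (r a)%:~R| <= 2^-1.

Definition approx_error (R : realType) (L : nat -> (R -> R) -> R -> R)
    (f : R -> R) (n : nat) : R :=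
  supnorm (fun x => L n f x - f x).

Definition trivial_class (R : realType) (L : nat -> (R -> R) -> R -> R) :
    set (R -> R) :=
  [set f | C01 f /\
    forall n, (0 < n)%N -> forall x, x \in `[0, 1] -> L n f x = f x].

Definition saturation_class (R : realType) (L : nat -> (R -> R) -> R -> R)
    (rate : nat -> R) : set (R -> R) :=
  [set f | C01 f /\ approx_error L f =O_\oo rate].

Definition saturated (R : realType) (L : nat -> (R -> R) -> R -> R)
    (rate : nat -> R) : Prop :=
  (forall f, C01 f -> approx_error L f =o_\oo rate -> trivial_class L f) /\
  (exists f, [/\ C01 f, ~ trivial_class L f & approx_error L f =O_\oo rate]).

Definition absolutely_continuous (R : realType) (a b : R) (f : R -> R) : Prop :=
  forall e : R, 0 < e -> exists2 d : R, 0 < d &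
    forall (n : nat) (u v : 'I_n -> R),
      (forall i, [/\ a <= u i, u i < v i & v i <= b]) ->
      trivIset [set: 'I_n] (fun i => `]u i, v i[%classic) ->
      \sum_(i < n) (v i - u i) < d ->
      \sum_(i < n) `|f (v i) - f (u i)| < e.

Definition AC01 (R : realType) : set (R -> R) :=
  [set f : R -> R | absolutely_continuous 0 1 f].

Definition ACloc01 (R : realType) : set (R -> R) :=
  [set f : R -> R | forall a b : R, 0 < a -> a < b -> b < 1 -> absolutely_continuous a b f].

(* The elements of L_infty are classes modulo a.e. equality (f'' below exists
   only a.e.), while measurability in [Lfun] is Borel measurability; hence the
   a.e. equal representative h. *)
Definition Linfty01 (R : realType) : set (R -> R) :=
  [set g : R -> R | exists2 h : R -> R, h \in Lfun (@lebesgue_measure R) +oo%E &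
    ae_eq (@lebesgue_measure R) `[0, 1]%classic g h].

(* Main.v *)
(* Let B_n be the unrounded Bernstein operator and q(x) = x(1 - x).  At a fixed
   x in ]0, 1[ the rounding error is at most (n + 1) max(x, 1 - x)^n, hence
   negligible; if f(0) and f(1) are integers it is at most 1/n uniformly, since
   'C(n, k) >= n for 0 < k < n.  Evaluating the error at 0 and 1 forces f(0) and
   f(1) to be integers.  So everything reduces to B_n.

   Inverse part (after Bajsanski and Bojanic).  If |B_n f - f| <= K/n and a
   parabola with leading coefficient a touches f from above at x, positivity of
   B_n and its second and fourth central moments give - K <= a q(x).  Comparing
   f with its chords, all second divided differences of f are bounded by A on
   every interval where K < A q; hence f' exists and is locally Lipschitz, and
   q |f''| <= 2(K + 1) where f'' exists.  With K = 0, f is affine.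

   Direct part.  If q |f''| <= M almost everywhere, then the increments of f' are
   dominated by those of M (ln x - ln (1 - x)), so the Taylor remainder of f at x
   is at most M times that of the negative entropy t ln t + (1 - t) ln (1 - t),
   i.e. M times a Kullback-Leibler divergence, which is at most
   M (t - x)^2 / q(x); applying B_n yields M/n.

   This uses that an absolutely continuous function is almost everywhere
   differentiable and is the integral of its derivative: its total variation is
   again absolutely continuous, so it is a difference of two nondecreasing
   functions whose Stieltjes measures have Radon-Nikodym densities, and the
   Lebesgue differentiation theorem applies. *)

Require Import Defs.
From HB Require Import structures.
From mathcomp Require Import all_boot all_order all_algebra.
From mathcomp Require Import all_classical all_reals all_analysis.
From mathcomp Require Import measurable_realfun ess_sup_inf.
From mathcomp Require Import ring lra.
Import Order.TTheory GRing.Theory Num.Theory.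
Import numFieldNormedType.Exports.

Set Implicit Arguments.
Unset Strict Implicit.
Unset Printing Implicit Defensive.

Local Open Scope classical_set_scope.
Local Open Scope ring_scope.

(** * Moments of the Bernstein operators *)

(** The values are indexed by [k] and not by the node [k / n], which changes with [n]; this allows a
    recursion on [n]. *)
Definition binomial_mean (R : realType) (n : nat) (a : nat -> R) (x : R) : R :=
  \sum_(k < n.+1) a k * 'C(n, k)%:R * x ^+ k * (1 - x) ^+ (n - k).

Lemma eq_binomial_mean (R : realType) n (a b : nat -> R) x :
  a =1 b -> binomial_mean n a x = binomial_mean n b x.
Proof. by move=> ab; apply: eq_bigr => k _; rewrite ab. Qed.

Lemma binomial_meanD (R : realType) n (a b : nat -> R) x :
  binomial_mean n (fun k => a k + b k) x =
  binomial_mean n a x + binomial_mean n b x.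
Proof. by rewrite -big_split; apply: eq_bigr => k _ /=; rewrite !mulrDl. Qed.

Lemma binomial_meanZ (R : realType) n c (a : nat -> R) x :
  binomial_mean n (fun k => c * a k) x = c * binomial_mean n a x.
Proof. by rewrite mulr_sumr; apply: eq_bigr => k _; rewrite !mulrA. Qed.

Lemma ler_binomial_mean (R : realType) n (a b : nat -> R) x : 0 <= x <= 1 ->
  (forall k, (k <= n)%N -> a k <= b k) ->
  binomial_mean n a x <= binomial_mean n b x.
Proof.
move=> /andP[x0 x1] ab; apply: ler_sum => k _.
by rewrite -!mulrA ler_wpM2r ?ab ?mulr_ge0 ?exprn_ge0 ?subr_ge0// -ltnS.
Qed.

(** Conditioning on one of [n.+1] Bernoulli trials: a success, of probability [x], shifts the index.
    In the proof this is Pascal's rule. *)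
Lemma binomial_meanS (R : realType) n (a : nat -> R) x :
  binomial_mean n.+1 a x =
  x * binomial_mean n (fun k => a k.+1) x + (1 - x) * binomial_mean n a x.
Proof.
rewrite /binomial_mean big_ord_recl/= bin0 subn0.
under eq_bigr => k _ do
  rewrite /bump/= add1n binS natrD mulrDr 2!mulrDl subSS.
rewrite big_split/= addrA addrC; congr (_ + _).
- rewrite mulr_sumr; apply: eq_bigr => k _; rewrite exprS; ring.
- rewrite big_ord_recr/= bin_small// mulr0 !mul0r addr0 mulr_sumr.
  rewrite [RHS]big_ord_recl/= bin0 subn0 (exprS (1 - x)); congr (_ + _); first by ring.
  apply: eq_bigr => k _; rewrite /bump/= add1n -(subnSK (ltn_ord k)) (exprS (1 - x)); ring.
Qed.

Lemma binomial_mean1 (R : realType) n (x : R) :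
  binomial_mean n (fun=> 1) x = 1.
Proof.
elim: n => [|n IH]; last by rewrite binomial_meanS IH; ring.
by rewrite /binomial_mean big_ord_recl big_ord0/= bin0 !expr0; ring.
Qed.

Definition central_moment (R : realType) n j (x : R) :=
  binomial_mean n (fun k => (k%:R - n%:R * x) ^+ j) x.

Lemma central_moment0 (R : realType) j (x : R) :
  central_moment 0 j.+1 x = 0.
Proof.
rewrite /central_moment /binomial_mean big_ord_recl big_ord0/= mul0r subr0.
by rewrite expr0n/= !mul0r addr0.
Qed.

Lemma central_moment_expand (R : realType) n j (x c : R) :
  binomial_mean n (fun k => (k%:R - n%:R * x + c) ^+ j) x =
  \sum_(i < j.+1) 'C(j, i)%:R * c ^+ i * central_moment n (j - i) x.
Proof.
rewrite /central_moment.
under eq_binomial_mean => k do rewrite exprDn.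
have -> : (fun k => \sum_(i < j.+1) (k%:R - n%:R * x) ^+ (j - i) * c ^+ i *+ 'C(j, i))
  = (fun k : nat => \sum_(i < j.+1) ('C(j, i)%:R * c ^+ i) * (k%:R - n%:R * x) ^+ (j - i)).
  by apply/funext => k; apply: eq_bigr => i _; rewrite -mulr_natl; ring.
rewrite /binomial_mean; under eq_bigr => k _ do rewrite !mulr_suml.
rewrite exchange_big/=; apply: eq_bigr => i _; rewrite mulr_sumr.
by apply: eq_bigr => k _; ring.
Qed.

(** One trial adds an independent variable equal to [1 - x] with probability [x] and to [- x]
    otherwise; the middle factor is its moment of order [i]. *)
Lemma central_momentS (R : realType) n j (x : R) :
  central_moment n.+1 j x = \sum_(i < j.+1) 'C(j, i)%:R *
    (x * (1 - x) ^+ i + (1 - x) * (- x) ^+ i) * central_moment n (j - i) x.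
Proof.
rewrite {1}/central_moment binomial_meanS.
under eq_binomial_mean => k.
  rewrite (_ : _ - _ = k%:R - n%:R * x + (1 - x)); last by rewrite !mulrS; ring.
  over.
under [X in _ + _ * X]eq_binomial_mean => k.
  rewrite (_ : _ - _ = k%:R - n%:R * x + (- x)); last by rewrite !mulrS; ring.
  over.
rewrite !central_moment_expand !mulr_sumr -big_split.
by apply: eq_bigr => i _ /=; ring.
Qed.

(** Orders 1 to 4 go through a single induction, since the recursion for each order involves the
    lower ones. *)
Lemma central_momentE (R : realType) n (x : R) :
  [/\ central_moment n 0 x = 1,
      central_moment n 1 x = 0,
      central_moment n 2 x = n%:R * (x * (1 - x)),
      central_moment n 3 x = n%:R * (x * (1 - x) * (1 - 2 * x)) &
      central_moment n 4 x = 3 * n%:R ^+ 2 * (x * (1 - x)) ^+ 2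
        + n%:R * (x * (1 - x) * (1 - 6 * (x * (1 - x))))].
Proof.
have m0 m : central_moment m 0 x = 1.
  by rewrite -(binomial_mean1 m x); apply: eq_binomial_mean => k; rewrite expr0.
elim: n => [|n [_ m1 m2 m3 m4]].
  by rewrite !central_moment0 m0 !mul0r expr0n/= mulr0 mul0r addr0.
rewrite !central_momentS !big_ord_recl !big_ord0 /= !subn0 !subn1 !subn2/= m0 m1 m2 m3 m4.
rewrite /bump/= !add1n ?add0n /= !binS !bin0 ?bin0n ?m0 ?m1 ?m2 ?m3 ?m4 /=.
rewrite /subn/= ?m0 ?m1 ?m2 ?m3 ?m4 mulrS.
by split; ring.
Qed.

Definition bernstein (R : realType) (n : nat) (f : R -> R) (x : R) : R :=
  binomial_mean n (fun k => f (k%:R / n%:R)) x.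

Lemma bernsteinN (R : realType) n (f : R -> R) x :
  bernstein n (\- f) x = - bernstein n f x.
Proof.
rewrite -mulN1r -binomial_meanZ; apply: eq_binomial_mean => k /=.
by rewrite mulN1r.
Qed.

Lemma node_in01 (R : realType) (k n : nat) : (0 < n)%N -> (k <= n)%N ->
  0 <= (k%:R / n%:R : R) <= 1.
Proof.
move=> n0 kn; rewrite divr_ge0//= ler_pdivrMr ?ltr0n//.
by rewrite mul1r ler_nat.
Qed.

(** The fourth power serves to dominate, away from [x], a function that the parabola majorizes only
    near [x]. *)
Lemma bernstein_quartic (R : realType) n (c b a C x : R) : (0 < n)%N ->
  bernstein n (fun t => c + b * (t - x) + a * (t - x) ^+ 2 + C * (t - x) ^+ 4) x
  = c + a * (x * (1 - x)) / n%:R + C * central_moment n 4 x / n%:R ^+ 4.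
Proof.
move=> n0; have nn0 : n%:R != 0 :> R by rewrite pnatr_eq0 -lt0n.
have [m0 m1 m2 _ _] := central_momentE n x.
have E j : binomial_mean n (fun k => (k%:R / n%:R - x) ^+ j) x =
    n%:R ^- j * central_moment n j x.
  rewrite -binomial_meanZ; apply: eq_binomial_mean => k.
  by rewrite -exprVn -exprMn; congr (_ ^+ _); field.
rewrite /bernstein !binomial_meanD !binomial_meanZ.
rewrite (_ : binomial_mean n (fun=> c) x = c); last first.
  rewrite -[RHS]mulr1 -(binomial_mean1 n x) -binomial_meanZ.
  by apply: eq_binomial_mean => k; rewrite mulr1.
rewrite -[binomial_mean n (fun k => k%:R / n%:R - x) x]/(binomial_mean n (fun k => (k%:R / n%:R - x) ^+ 1) x) !E m1 m2.
by field.
Qed.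

Lemma bernstein_le (R : realType) n (f g : R -> R) x : (0 < n)%N ->
  0 <= x <= 1 -> (forall t, 0 <= t <= 1 -> f t <= g t) ->
  bernstein n f x <= bernstein n g x.
Proof.
by move=> n0 x01 fg; apply: ler_binomial_mean => // k kn; exact/fg/node_in01.
Qed.

(** As x(1 - x) <= 1/4, the two terms of the moment are at most 3/16 n^2 and 1/4 n^2. *)
Lemma central_moment4_le (R : realType) n (x : R) : (0 < n)%N ->
  0 <= x <= 1 -> central_moment n 4 x <= n%:R ^+ 2.
Proof.
move=> n0 /andP[x0 x1]; have [_ _ _ _ ->] := central_momentE n x.
have n1 : 1 <= n%:R :> R by rewrite ler1n.
set p := x * (1 - x).
have p0 : 0 <= p by rewrite mulr_ge0// subr_ge0.
have p4 : p <= 4^-1 by have := sqr_ge0 (x - 2^-1); rewrite /p; nra.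
have : n%:R * (p * (1 - 6 * p)) <= n%:R ^+ 2 * 4^-1.
  rewrite expr2 -mulrA ler_wpM2l// (@le_trans _ _ 4^-1)//.
    by have := sqr_ge0 p; nra.
  by rewrite ler_peMl// invr_ge0.
have : p ^+ 2 <= 16^-1 by nra.
have := sqr_ge0 (n%:R : R); nra.
Qed.

(** By positivity the majorant passes to the operator; its quartic part costs only O(n^-2). *)
Lemma bernstein_touch (R : realType) n (f : R -> R) (b a C x : R) : (0 < n)%N ->
  0 <= x <= 1 -> 0 <= C ->
  (forall t, 0 <= t <= 1 ->
    f t <= f x + b * (t - x) + a * (t - x) ^+ 2 + C * (t - x) ^+ 4) ->
  bernstein n f x - f x <= a * (x * (1 - x)) / n%:R + C / n%:R ^+ 2.
Proof.
move=> n0 x01 C0 ft; have np : 0 < n%:R :> R by rewrite ltr0n.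
rewrite lerBlDl addrA; apply: le_trans (bernstein_le n0 x01 ft) _.
rewrite bernstein_quartic// lerD2l.
apply: (@le_trans _ _ (C * n%:R ^+ 2 / n%:R ^+ 4)).
  by rewrite ler_wpM2r ?invr_ge0 ?exprn_ge0// ler_wpM2l// central_moment4_le.
by rewrite le_eqVlt; apply/orP; left; apply/eqP; field; rewrite gt_eqF.
Qed.

(** * The effect of rounding the coefficients *)

(** All that is used of the floor and of the nearest integer, so that both operators are treated at
    once. *)
Definition rounding (R : realType) (r : R -> int) :=
  (forall a, `|(r a)%:~R - a| <= 1) /\ (forall z : int, r z%:~R = z).

Lemma rounding_floor (R : realType) : rounding (@Num.floor R).
Proof.
split=> [a|z]; last exact: intrKfloor.
have := ge_floor a; have := ltW (floorD1_gt a); rewrite intrD.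
by move=> h1 h2; rewrite ler_norml; lra.
Qed.

(** At an integer the error is itself an integer of absolute value at most 1/2, hence zero, whatever
    the choice at half-integers. *)
Lemma rounding_nearest (R : realType) (r : R -> int) :
  nearest_integer r -> rounding r.
Proof.
move=> hr; split=> [a|z]; first by rewrite distrC; apply: le_trans (hr a) _; lra.
have := hr z%:~R; rewrite -intrB -intr_norm => h.
have : `|z - r z%:~R| < 1.
  by rewrite -(ltr_int R); apply: le_lt_trans h _; rewrite invf_lt1 ?ltr0n// ltr1n.
by rewrite ltz_nat /= ltnS leqn0 absz_eq0 subr_eq0 => /eqP.
Qed.

Lemma rounded_bernstein_dist (R : realType) (r : R -> int) n f x :
  (forall a, `|(r a)%:~R - a| <= 1) -> 0 <= x <= 1 ->
  `|rounded_bernstein r n f x - bernstein n f x| <=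
    \sum_(k < n.+1) x ^+ k * (1 - x) ^+ (n - k).
Proof.
move=> hr /andP[x0 x1].
rewrite -sumrB; apply: le_trans (ler_norm_sum _ _ _) _; apply: ler_sum => k _.
rewrite -mulrA -[X in _ - X]mulrA -mulrBl normrM -[leRHS]mul1r.
have w0 : 0 <= x ^+ k * (1 - x) ^+ (n - k) by rewrite mulr_ge0 ?exprn_ge0 ?subr_ge0.
by rewrite [X in _ * X]ger0_norm// ler_wpM2r.
Qed.

(** 1 - q^n = (1 - q)(1 + q + ... + q^(n-1)), and each of the [n] summands is at least q^n. *)
Lemma natr_expr_le (R : realType) (q : R) n : 0 <= q <= 1 ->
  n%:R * q ^+ n * (1 - q) <= 1.
Proof.
move=> /andP[q0 q1]; apply: (@le_trans _ _ (1 - q ^+ n)); last first.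
  by rewrite gerBl exprn_ge0.
elim: n => [|n IH]; first by rewrite expr0 subrr !mul0r.
have qn : q ^+ n.+1 <= 1 by rewrite exprn_ile1.
rewrite exprS in qn *; rewrite mulrS; nra.
Qed.

Lemma expr_decay (R : realType) (p : R) : 0 <= p < 1 ->
  exists2 D : R, 0 <= D & forall n, (0 < n)%N -> n.+1%:R * p ^+ n <= D / n%:R ^+ 2.
Proof.
(* With q the fourth root of p, the fourth power of n q^n (1 - q) <= 1 gives n^4 p^n <= (1 - q)^-4;
   moreover (n + 1) n^2 <= 2 n^4. *)
move=> /andP[p0 p1]; pose q := Num.sqrt (Num.sqrt p).
have q4 : q ^+ 4 = p by rewrite -[4%N]/(2 * 2)%N exprM !sqr_sqrtr ?sqrtr_ge0.
have q0 : 0 <= q by exact: sqrtr_ge0.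
have q1 : q < 1.
  by rewrite ltNge; apply/negP => /(exprn_ege1 4); rewrite q4 leNgt p1.
exists (2 * (1 - q) ^- 4) => [|n n0].
  by rewrite mulr_ge0// invr_ge0 exprn_ge0// subr_ge0 ltW.
have np : 0 < n%:R :> R by rewrite ltr0n.
rewrite ler_pdivlMr ?exprn_gt0// ler_pdivlMr ?exprn_gt0 ?subr_gt0//.
have := @natr_expr_le _ q n; rewrite q0 ltW// => /(_ isT) h.
have h4 : (n%:R * q ^+ n * (1 - q)) ^+ 4 <= 1.
  by rewrite exprn_ile1// !mulr_ge0 ?exprn_ge0// subr_ge0 ltW.
apply: le_trans (_ : 2 * (n%:R * q ^+ n * (1 - q)) ^+ 4 <= _); last by nra.
rewrite (_ : 2 * _ = 2 * n%:R ^+ 4 * (p ^+ n * (1 - q) ^+ 4)); last first.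
  by rewrite !exprMn -exprM mulnC exprM q4; ring.
rewrite (_ : _ * (1 - q) ^+ 4 = n.+1%:R * n%:R ^+ 2 * (p ^+ n * (1 - q) ^+ 4));
  last by ring.
rewrite ler_wpM2r ?mulr_ge0 ?exprn_ge0 ?subr_ge0 ?(ltW q1)//.
rewrite (_ : 2 * n%:R ^+ 4 = (n%:R + n%:R) * n%:R * n%:R ^+ 2 :> R); last by ring.
rewrite ler_wpM2r ?exprn_ge0// (@le_trans _ _ (n%:R + n%:R))//.
  by rewrite -natr1 lerD2l ler1n.
by rewrite ler_peMr ?addr_ge0// ler1n.
Qed.

(** Each of the n + 1 monomials is at most p^n with p < 1. [D] depends on [x], but on neither [n]
    nor [f]. *)
Lemma rounded_bernstein_pointwise (R : realType) (r : R -> int) x :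
  (forall a, `|(r a)%:~R - a| <= 1) -> 0 < x < 1 ->
  exists2 D : R, 0 <= D & forall n f, (0 < n)%N ->
    `|rounded_bernstein r n f x - bernstein n f x| <= D / n%:R ^+ 2.
Proof.
move=> hr /andP[x0 x1]; pose p := Num.max x (1 - x).
have p01 : 0 <= p < 1 by rewrite le_max (ltW x0)/= gt_max x1/=; lra.
have /andP[p0 _] := p01.
have [D D0 hD] := expr_decay p01; exists D => // n f n0.
apply: le_trans (hD n n0); apply: le_trans (rounded_bernstein_dist _ _ hr _) _.
  by rewrite (ltW x0) (ltW x1).
rewrite mulr_natl -[X in _ *+ X]card_ord -sumr_const; apply: ler_sum => k _.
have -> : p ^+ n = p ^+ k * p ^+ (n - k) by rewrite -exprD subnKC// -ltnS.
apply: ler_pM; rewrite ?exprn_ge0 ?subr_ge0 ?(ltW x0) ?(ltW x1)//.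
- by rewrite lerXn2r ?nnegrE ?(ltW x0)// le_max lexx.
- by rewrite lerXn2r ?nnegrE ?subr_ge0 ?(ltW x1)// le_max lexx orbT.
Qed.

Lemma leq_bin n k : (0 < k < n)%N -> (n <= 'C(n, k))%N.
Proof.
elim: n k => [|n IH] [|k]//=; rewrite ltnS => kn; rewrite binS.
case: k kn => [|k] kn; first by rewrite bin0 addn1 bin1.
have [kn'|nk] := ltnP k.+2 n.
  by rewrite -addn1 leq_add ?IH// bin_gt0 ltnW.
have -> : n = k.+2 by apply/eqP; rewrite eqn_leq nk.
by rewrite binn binSn.
Qed.

Lemma rounded_bernstein_uniform (R : realType) (r : R -> int) n f x :
  rounding r -> f 0 \is a Num.int -> f 1 \is a Num.int -> 0 <= x <= 1 ->
  (0 < n)%N ->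
  `|rounded_bernstein r n f x - bernstein n f x| <= n%:R^-1.
Proof.
move=> [hr rint] /intrP[z0 f0] /intrP[z1 f1] /andP[x0 x1] n0.
have np : 0 < n%:R :> R by rewrite ltr0n.
rewrite -sumrB; apply: le_trans (ler_norm_sum _ _ _) _.
(* The bound 1/n is the mean of the constant 1/n, so the two sums can be compared term by term. *)
rewrite [leRHS](_ : _ = binomial_mean n (fun=> n%:R^-1 * 1) x); last first.
  by rewrite binomial_meanZ binomial_mean1 mulr1.
apply: ler_sum => k _; set w := x ^+ k * (1 - x) ^+ (n - k).
have w0 : 0 <= w by rewrite mulr_ge0 ?exprn_ge0 ?subr_ge0.
set a := f _ * 'C(n, k)%:R.
rewrite (_ : _ - _ = ((r a)%:~R - a) * w); last by rewrite /w; ring.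
rewrite (_ : n%:R^-1 * 1 * _ * _ * _ = n%:R^-1 * 'C(n, k)%:R * w); last first.
  by rewrite /w; ring.
rewrite normrM [X in _ * X]ger0_norm// ler_wpM2r// {}/a.
have [k0|kpos] := posnP k.
  rewrite k0 mul0r bin0 mulr1 f0 rint subrr normr0 mulr1 invr_ge0 ltW//.
have [kn|kn] := eqVneq (k : nat) n.
  rewrite kn divff ?gt_eqF// binn mulr1 f1 rint subrr normr0 mulr1 invr_ge0 ltW//.
apply: le_trans (hr _) _; rewrite mulrC ler_pdivlMr// mul1r ler_nat.
have kltn : (k < n)%N by rewrite ltn_neqAle kn -ltnS ltn_ord.
by rewrite leq_bin// kpos.
Qed.

(** * Parabolas touching a function *)

(** The inequality q f'' / 2 >= - K in the viscosity sense, with q(x) = x(1 - x): it is tested on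
    parabolas touching [f] from above. For [\- f] it bounds f'' from above. *)
Definition touch_bound (R : realType) (K : R) (f : R -> R) :=
  forall x a b d : R, 0 < x < 1 -> 0 < d ->
  (forall t, 0 <= t <= 1 -> `|t - x| < d ->
     f t <= f x + b * (t - x) + a * (t - x) ^+ 2) ->
  - K <= a * (x * (1 - x)).

(** [D] and [N] may depend on [x], because the rounding error is O(n^-2) only at each fixed interior
    point. *)
Definition bernstein_rate (R : realType) (K : R) (f : R -> R) :=
  forall x : R, 0 < x < 1 -> exists D N, forall n, (N < n)%N ->
    `|bernstein n f x - f x| <= K / n%:R + D / n%:R ^+ 2.

Lemma bernstein_rateN (R : realType) (K : R) f :
  bernstein_rate K f -> bernstein_rate K (\- f).
Proof.
move=> H x /H[D [N h]]; exists D, N => n /h; rewrite bernsteinN /=.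
by rewrite -opprD normrN.
Qed.

Lemma bernstein_rate_touch (R : realType) (K B : R) f :
  (forall t, 0 <= t <= 1 -> `|f t| <= B) ->
  bernstein_rate K f -> touch_bound K f.
Proof.
move=> fB H x a b d x01 d0 ft; have [D [N hD]] := H _ x01.
have /andP[/ltW x0 /ltW x1] := x01.
have fxB : `|f x| <= B by rewrite fB ?x0.
have B0 : 0 <= B := le_trans (normr_ge0 _) fxB.
(* Where |t - x| >= d, the term C (t - x)^4 is at least this numerator, which makes up for |f t - f
   x| and for the parabola, as |t - x| <= 1. *)
pose C := (2 * B + `|b| + `|a|) / d ^+ 4.
have C0 : 0 <= C by rewrite divr_ge0 ?exprn_ge0 ?addr_ge0 ?mulr_ge0 ?(ltW d0).
have gft t : 0 <= t <= 1 ->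
    f t <= f x + b * (t - x) + a * (t - x) ^+ 2 + C * (t - x) ^+ 4.
  move=> t01; have [/(ft _ t01) h|dt] := ltP (`|t - x|) d.
    by apply: le_trans h _; rewrite lerDl mulr_ge0// exprn_even_ge0.
  have tx1 : `|t - x| <= 1 by move: t01; rewrite ler_norml; lra.
  have h1 : - `|b| <= b * (t - x).
    by rewrite lerNl (le_trans (ler_norm _))// normrN normrM ler_piMr.
  have h2 : - `|a| <= a * (t - x) ^+ 2.
    rewrite lerNl (le_trans (ler_norm _))// normrN normrM ler_piMr//.
    by rewrite normrX exprn_ile1.
  have h3 : 2 * B + `|b| + `|a| <= C * (t - x) ^+ 4.
    rewrite /C mulrAC ler_pdivlMr ?exprn_gt0// ler_wpM2l//.
      by rewrite !addr_ge0// mulr_ge0.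
    rewrite -[leRHS]ger0_norm ?exprn_even_ge0// normrX lerXn2r// ?nnegrE//.
    exact: ltW.
  have := fB _ t01; have := fxB; rewrite !ler_norml => /andP[h4 _] /andP[_ h5].
  lra.
(* The two bounds on B_n f - f give - K/n - D/n^2 <= a q/n + C/n^2 with q = x(1 - x). Multiplied by
   n, this yields the claim up to [e] once (C + D)/n <= e. *)
rewrite -subr_le0; apply/ler_addgt0Pl => e e0; rewrite addr0.
have [m me] : exists m : nat, (`|C + D| + 1) / e < m%:R.
  by exists (Num.bound ((`|C + D| + 1) / e)); rewrite archi_boundP// divr_ge0 ?ltW// addr_ge0.
pose n := (N + m).+1.
have np : 0 < n%:R :> R by rewrite ltr0n.
have nm : m%:R <= n%:R :> R by rewrite ler_nat /n leqW// leq_addl.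
have x01' : 0 <= x <= 1 by rewrite x0.
have := @bernstein_touch _ n f b a C x isT x01' C0 gft.
have : (N < n)%N by rewrite ltnS leq_addr.
move=> /hD; rewrite ler_norml => /andP[h1 _] h2.
have h3 : - (K / n%:R + D / n%:R ^+ 2) <= a * (x * (1 - x)) / n%:R + C / n%:R ^+ 2.
  exact: le_trans h1 h2.
have h4 : (- K - a * (x * (1 - x))) * n%:R <= C + D.
  rewrite -(@ler_pM2r _ (n%:R ^- 2)) ?invr_gt0 ?exprn_gt0//.
  rewrite -subr_ge0 in h3; rewrite -subr_ge0; apply: le_trans h3 _.
  by rewrite le_eqVlt; apply/orP; left; apply/eqP; field; rewrite gt_eqF.
rewrite ltr_pdivrMr// in me.
rewrite -(@ler_pM2r _ n%:R)//; apply: le_trans h4 _.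
apply: le_trans (ler_norm _) _; rewrite mulrC; nra.
Qed.

Definition chord (R : realType) (f : R -> R) (u v t : R) : R :=
  f u + (f v - f u) / (v - u) * (t - u).

(** A maximum principle: at an interior maximum of [f] minus the chord minus A (t - u)(v - t), a
    parabola with leading coefficient [- A] touches [f] from above, so that A x(1 - x) <= K
    there. *)
Lemma chord_le (R : realType) (K A u v : R) (f : R -> R) :
  touch_bound K f -> {within `[0, 1], continuous f} ->
  0 <= u -> u < v -> v <= 1 ->
  (forall x, u < x < v -> K < A * (x * (1 - x))) ->
  forall w, u <= w <= v -> f w - chord f u v w <= A * ((w - u) * (v - w)).
Proof.
move=> H cf u0 uv v1 HA w wuv.
pose G t := f t - (chord f u v t + A * ((t - u) * (v - t))).
have cG : {within `[u, v], continuous G}.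
  move=> t; apply: (@continuousB _ _ _ (f : subspace `[u, v]%classic -> R)
    (fun t => chord f u v t + A * ((t - u) * (v - t)))).
    move: t; apply: continuous_subspaceW cf => t /=.
    rewrite !in_itv/= => /andP[h1 h2]; rewrite (le_trans u0 h1)/=.
    exact: le_trans h2 v1.
  move: t; apply: continuous_subspaceT => t; rewrite /chord.
  apply: cvgD; first apply: cvgD; [exact: cvg_cst|..].
    by apply: cvgM; [exact: cvg_cst|apply: cvgB; [exact: cvg_id|exact: cvg_cst]].
  apply: cvgM; [exact: cvg_cst|apply: cvgM].
    by apply: cvgB; [exact: cvg_id|exact: cvg_cst].
  by apply: cvgB; [exact: cvg_cst|exact: cvg_id].
have [c cuv Gmax] := EVT_max (ltW uv) cG.
have vu : v - u != 0 by rewrite subr_eq0 gt_eqF.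
have Gu : G u = 0 by rewrite /G /chord; ring.
have Gv : G v = 0 by rewrite /G /chord; field.
suff : G c <= 0.
  move=> Gc; have := Gmax w; rewrite in_itv/= wuv => /(_ isT) h.
  by move: (le_trans h Gc); rewrite /G; lra.
rewrite leNgt; apply/negP => Gc.
rewrite in_itv/= in cuv; move/andP: cuv => [uc cv].
have {}uc : u < c by rewrite lt_neqAle uc andbT; apply: contraTneq Gc => <-; rewrite Gu ltxx.
have {}cv : c < v by rewrite lt_neqAle cv andbT; apply: contraTneq Gc => ->; rewrite Gv ltxx.
have := HA c; rewrite uc cv => /(_ isT); apply/negP; rewrite -leNgt.
rewrite -lerN2 -mulNr.
(* The slope is that of the chord plus the derivative of A (t - u)(v - t) at [c]; the radius keeps
   [t] in [u, v]. *)
apply: (H c _ ((f v - f u) / (v - u) + A * (u + v - 2 * c)) (Num.min (c - u) (v - c))).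
- by rewrite (le_lt_trans u0 uc)/= (lt_le_trans cv v1).
- by rewrite lt_min !subr_gt0 uc.
- move=> t _; rewrite lt_min !ltr_norml => /andP[h1 h2].
  have := Gmax t; rewrite in_itv/= => /(_ _)/wrap[]; first lra.
  rewrite /G /chord; set s := _ / (v - u); nra.
Qed.

Lemma chord_dist (R : realType) (K A u v : R) (f : R -> R) :
  touch_bound K f -> touch_bound K (\- f) ->
  {within `[0, 1], continuous f} ->
  0 <= u -> u < v -> v <= 1 ->
  (forall x, u < x < v -> K < A * (x * (1 - x))) ->
  forall w, u <= w <= v -> `|f w - chord f u v w| <= A * ((w - u) * (v - w)).
Proof.
move=> H1 H2 cf u0 uv v1 HA w wuv; rewrite ler_norml; apply/andP; split; last first.
  exact: (@chord_le _ K).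
have := @chord_le _ K A u v (\- f) H2 _ u0 uv v1 HA w wuv.
rewrite lerNl; set X := _ - chord _ _ _ _; set Y := f w - _.
have -> : X = - Y by rewrite /X /Y /chord/=; ring.
by apply => t; exact: (cvgN (cf t)).
Qed.

(** With K = 0 every A = e > 0 is admissible on all of [0, 1], so [f] is within any e of its
    chord. *)
Lemma touch0_affine (R : realType) (f : R -> R) :
  touch_bound 0 f -> touch_bound 0 (\- f) -> {within `[0, 1], continuous f} ->
  forall w, 0 <= w <= 1 -> f w = f 0 + (f 1 - f 0) * w.
Proof.
move=> H1 H2 cf w w01; apply/eqP; rewrite -subr_eq0 -normr_le0.
apply/ler_addgt0Pl => e e0; rewrite addr0.
have := @chord_dist _ 0 e 0 1 f H1 H2 cf (lexx _) ltr01 (lexx _) _ w w01.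
rewrite /chord !subr0 divr1 => /(_ _)/wrap[].
  by move=> x /andP[x0 x1]; rewrite !mulr_gt0// subr_gt0.
move=> /le_trans; apply; rewrite ger_pMr//; case/andP: w01; nra.
Qed.

(** * Divided differences and regularity of the function *)

Definition slope (R : realType) (f : R -> R) (x y : R) : R := (f y - f x) / (y - x).

Lemma slopeC (R : realType) (f : R -> R) x y : slope f x y = slope f y x.
Proof. by rewrite /slope -opprB -[y - x]opprB invrN mulrNN. Qed.

(** The deviation from the chord at [w] is, up to sign, (w - u)(v - w)/(v - u) times the difference
    of the slopes over [w, v] and [u, w]. Hence second divided differences are at most [A] in
    absolute value. *)
Lemma slope_le_of_chord (R : realType) (A a b : R) (f : R -> R) :
  (forall u v, a <= u -> u < v -> v <= b -> forall w, u <= w <= v ->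
     `|f w - chord f u v w| <= A * ((w - u) * (v - w))) ->
  forall x y z, a <= x <= b -> a <= y <= b -> a <= z <= b -> y != x -> z != x ->
  `|slope f x y - slope f x z| <= A * `|y - z|.
Proof.
move=> H.
have D u w v : a <= u -> u < w -> w < v -> v <= b ->
    `|slope f w v - slope f u w| <= A * (v - u).
  move=> au uw wv vb; have uv := lt_trans uw wv.
  have wuv : u <= w <= v by rewrite (ltW uw) (ltW wv).
  have := H u v au uv vb w wuv.
  have wu0 : 0 < w - u by rewrite subr_gt0.
  have vw0 : 0 < v - w by rewrite subr_gt0.
  have vu0 : 0 < v - u by rewrite subr_gt0.
  have -> : f w - chord f u v w =
     - ((w - u) * (v - w) / (v - u)) * (slope f w v - slope f u w).
    by rewrite /chord /slope; field; rewrite !gt_eqF.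
  rewrite normrM normrN [X in X * _]ger0_norm; last first.
    by rewrite divr_ge0 ?mulr_ge0 ?ltW.
  rewrite mulrAC ler_pdivrMr// => h.
  rewrite -(ler_pM2l (mulr_gt0 wu0 vw0)); apply: le_trans h _.
  by rewrite [leRHS]mulrCA [leRHS]mulrA.
(* [D] settles the case of [x] between [y] and [z]. If [x] lies outside, the difference of slopes is
   a fraction of one covered by [D], and the fraction turns the total length into |y - z|. *)
move=> x y z xab yab zab yx zx.
wlog yz : y z yab zab yx zx / y < z => [W|].
  have [/W|zy|->] := ltgtP y z; first exact.
    by rewrite distrC [`|y - z|]distrC; exact: W.
  by rewrite !subrr normr0 mulr0.
rewrite [`|y - z|]distrC [`|z - y|]gtr0_norm ?subr_gt0//.
move: xab yab zab => /andP[ax xb] /andP[ay yb] /andP[az zb].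
have [xy|yx'|xy] := ltgtP x y; last by rewrite xy eqxx in yx.
- have xz := lt_trans xy yz; rewrite distrC.
  have -> : slope f x z - slope f x y =
      (z - y) / (z - x) * (slope f y z - slope f x y).
    by rewrite /slope; field; rewrite !subr_eq0 !gt_eqF.
  rewrite normrM [X in X * _]ger0_norm; last first.
    by rewrite divr_ge0// subr_ge0 ltW.
  rewrite mulrAC ler_pdivrMr ?subr_gt0// -[leRHS]mulrA [leRHS]mulrCA.
  by rewrite ler_wpM2l ?subr_ge0 ?(ltW yz)// D.
- have [xz|zx'|xz] := ltgtP x z; last by rewrite xz eqxx in zx.
    by rewrite distrC (slopeC f x y) D.
  rewrite (slopeC _ x y) (slopeC _ x z).
  have -> : slope f y x - slope f z x =
      - ((z - y) / (x - y)) * (slope f z x - slope f y z).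
    by rewrite /slope; field; rewrite !subr_eq0 !gt_eqF.
  rewrite normrM normrN [X in X * _]ger0_norm; last first.
    by rewrite divr_ge0// subr_ge0 ltW.
  rewrite mulrAC ler_pdivrMr ?subr_gt0// -[leRHS]mulrA [leRHS]mulrCA.
  by rewrite ler_wpM2l ?subr_ge0 ?(ltW yz)// D.
Qed.

Lemma near0_itv (R : realType) (x a b : R) : a < x < b ->
  \forall h \near (0 : R)^', a <= h *: 1 + x <= b /\ h *: 1 + x != x.
Proof.
move=> /andP[ax xb].
near=> h; rewrite /GRing.scale/= mulr1.
have h0 : h != 0 by near: h; exact: nbhs_dnbhs_neq.
rewrite -subr_eq0 addrK h0; split => //.
have : `|h| <= x - a by near: h; apply: dnbhs0_le; rewrite subr_gt0.
have : `|h| <= b - x by near: h; apply: dnbhs0_le; rewrite subr_gt0.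
rewrite !ler_norml; lra.
Unshelve. all: by end_near. Qed.

(** The slopes at [x] are Lipschitz in the other end point, hence Cauchy as it tends to [x]; the
    second claim is the limit z -> x of the hypothesis. *)
Lemma slope_derivable (R : realType) (A a b x : R) (f : R -> R) : 0 <= A ->
  a < x < b ->
  (forall y z, a <= y <= b -> a <= z <= b -> y != x -> z != x ->
    `|slope f x y - slope f x z| <= A * `|y - z|) ->
  derivable f x 1 /\
  forall y, a <= y <= b -> y != x -> `|slope f x y - derive1 f x| <= A * `|y - x|.
Proof.
move=> A0 axb H.
pose s := fun h : R => h^-1 *: (f (h *: 1 + x) - f x).
have sE h : h != 0 -> s h = slope f x (h *: 1 + x).
  by move=> h0; rewrite /s /slope addrK [h *: 1]mulr1 mulrC.
have df : derivable f x 1.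
  apply/cauchy_cvgP; apply/cauchy_exP => e e0.
  (* [A] may be zero, hence [A + 1]; two increments below this bound differ by at most e / (A +
     1). *)
  have d0 : 0 < e / (A + 1) / 2 by rewrite !divr_gt0// ltr_pwDr.
  have : \forall h \near (0 : R)^', [/\ h != 0, `|h| < e / (A + 1) / 2 &
      a <= h *: 1 + x <= b /\ h *: 1 + x != x].
    near=> h; split.
    - by near: h; exact: nbhs_dnbhs_neq.
    - by near: h; exact: dnbhs0_lt.
    - by near: h; exact: near0_itv.
  move=> N; have [h [h0 hd [habx hx]]] := filter_ex N.
  exists (s h) => /=; near=> k.
  have [k0 kd [kabx kx]] : [/\ k != 0, `|k| < e / (A + 1) / 2 &
      a <= k *: 1 + x <= b /\ k *: 1 + x != x] by near: k.
  rewrite /ball/= -/(s k) !sE//.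
  apply: le_lt_trans (H _ _ habx kabx hx kx) _.
  rewrite opprD addrACA subrr addr0 -scalerBl [_ *: 1]mulr1.
  have h1 : `|h - k| <= e / (A + 1).
    by rewrite (le_trans (ler_normB _ _))//; lra.
  apply: le_lt_trans (_ : A * (e / (A + 1)) < e); first by rewrite ler_wpM2l.
  by rewrite mulrA ltr_pdivrMr ?ltr_pwDr// mulrC ltr_pM2l// ltrDl.
split=> // y yab yx.
have sl : s h @[h --> 0^'] --> derive1 f x by rewrite derive1E; exact: df.
have sl' : `|slope f x y - s h| - A * `|y - (h *: 1 + x)| @[h --> 0^'] -->
    `|slope f x y - derive1 f x| - A * `|y - (0 *: 1 + x)|.
  apply: cvgB; first by apply: cvg_norm; apply: cvgB => //; exact: cvg_cst.
  apply: cvgM; first exact: cvg_cst.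
  apply: cvg_norm; apply: cvgB; first exact: cvg_cst.
  apply: cvgD; last exact: cvg_cst.
  by apply: (@cvgM _ _ _ _ (fun h : R => h) (fun=> 1)); [exact: cvg_within|exact: cvg_cst].
rewrite scale0r add0r in sl'; rewrite -subr_le0.
apply: (cvgr_to_le sl'); near=> h.
have [h0 [hab hx]] : h != 0 /\ a <= h *: 1 + x <= b /\ h *: 1 + x != x.
  by split; near: h; [exact: nbhs_dnbhs_neq|exact: near0_itv].
by rewrite sE// subr_le0 H.
Unshelve. all: by end_near. Qed.

Lemma derive1_le_lipschitz (R : realType) (A a b x : R) (g : R -> R) :
  a < x < b -> (forall y, a <= y <= b -> `|g y - g x| <= A * `|y - x|) ->
  derivable g x 1 -> `|derive1 g x| <= A.
Proof.
move=> axb H dg.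
have sl : `|h^-1 *: (g (h *: 1 + x) - g x)| @[h --> 0^'] --> `|derive1 g x|.
  by rewrite derive1E; apply: cvg_norm; exact: dg.
apply: (cvgr_to_le sl); near=> h.
have h0 : h != 0 by near: h; exact: nbhs_dnbhs_neq.
have [hab _] : a <= h *: 1 + x <= b /\ h *: 1 + x != x by near: h; exact: near0_itv.
rewrite normrZ normfV mulrC ler_pdivrMr ?normr_gt0//.
by have := H _ hab; rewrite addrK [h *: 1]mulr1.
Unshelve. all: by end_near. Qed.

(** The slope over [x, y] is within A |y - x| of the derivatives at both ends, hence the factor
    2. *)
Lemma derive1_lipschitz_of_slope (R : realType) (A a b : R) (f : R -> R) :
  0 <= A ->
  (forall x y z, a <= x <= b -> a <= y <= b -> a <= z <= b -> y != x -> z != x ->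
    `|slope f x y - slope f x z| <= A * `|y - z|) ->
  (forall x, a < x < b -> derivable f x 1) /\
  (forall x y, a < x < b -> a < y < b ->
    `|derive1 f y - derive1 f x| <= 2 * A * `|y - x|).
Proof.
move=> A0 H; have W (x : R) : a < x < b -> a <= x <= b by case/andP=> /ltW-> /ltW->.
have D x : a < x < b -> derivable f x 1 /\
    forall y, a <= y <= b -> y != x -> `|slope f x y - derive1 f x| <= A * `|y - x|.
  move=> xab; apply: (@slope_derivable _ _ a b) => // y z.
  exact/H/W.
split=> [x /D[]//|x y xab yab].
have [->|yx] := eqVneq y x; first by rewrite !subrr normr0 mulr0.
have [_ /(_ y (W _ yab) yx) h1] := D x xab.
have [_ /(_ x (W _ xab))] := D y yab.
rewrite eq_sym yx => /(_ isT); rewrite slopeC => h2.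
rewrite -(subrK (slope f x y) (derive1 f y)) -addrA.
apply: le_trans (ler_normD _ _) _; rewrite distrC.
by rewrite distrC in h1 h2 *; rewrite [`|x - y|]distrC in h2; lra.
Qed.

Lemma bernstein_rate_regular (R : realType) (K : R) (f : R -> R) :
  0 <= K -> touch_bound K f -> touch_bound K (\- f) ->
  {within `[0, 1], continuous f} ->
  [/\ forall x : R, 0 < x < 1 -> derivable f x 1,
      forall a b : R, 0 < a -> a < b -> b < 1 -> exists2 L : R, 0 <= L &
        forall x y, a <= x <= b -> a <= y <= b ->
          `|derive1 f y - derive1 f x| <= L * `|y - x| &
      forall x : R, 0 < x < 1 -> derivable (derive1 f) x 1 ->
        `|x * (1 - x) * derive1 (derive1 f) x| <= 2 * (K + 1)].
Proof.
move=> K0 H1 H2 cf.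
have D (A a b : R) : 0 <= A -> 0 <= a -> b <= 1 ->
    (forall x, a < x < b -> K < A * (x * (1 - x))) ->
    (forall x, a < x < b -> derivable f x 1) /\
    (forall x y, a < x < b -> a < y < b ->
      `|derive1 f y - derive1 f x| <= 2 * A * `|y - x|).
  move=> A0 a0 b1 HA; apply: derive1_lipschitz_of_slope => //.
  apply: slope_le_of_chord => u v au uv vb.
  apply: (@chord_dist _ K) => //; first exact: le_trans au.
    exact: le_trans b1.
  move=> x /andP[ux xv]; apply: HA.
  by rewrite (le_lt_trans au ux) (lt_le_trans xv vb).
have G a b : 0 < a -> a <= b -> b < 1 -> exists2 L : R, 0 <= L &
    (forall x, a <= x <= b -> derivable f x 1) /\
    forall x y, a <= x <= b -> a <= y <= b ->
          `|derive1 f y - derive1 f x| <= L * `|y - x|.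
  (* [m] bounds x(1 - x) from below on [a/2, (1 + b)/2]; the interval is enlarged because the
     conclusions of [D] hold only in its interior. *)
  move=> a0 ab b1; pose m := a / 2 * ((1 - b) / 2).
  have m0 : 0 < m by rewrite mulr_gt0// divr_gt0// subr_gt0.
  have A0 : 0 <= (K + 1) / m by rewrite divr_ge0 ?addr_ge0// ltW.
  have [|||d1 d2] := @D ((K + 1) / m) (a / 2) ((1 + b) / 2) A0.
  - by rewrite divr_ge0// ltW.
  - lra.
  - move=> x xab; apply: (@lt_le_trans _ _ (K + 1)); first by rewrite ltrDl.
    rewrite mulrAC ler_pdivlMr// ler_wpM2l ?addr_ge0//.
    by rewrite /m ler_pM ?divr_ge0 ?subr_ge0 ?ltW//; lra.
  exists (2 * ((K + 1) / m)); first by rewrite mulr_ge0.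
  split=> [x xab|x y xab yab]; [apply: d1|apply: d2]; lra.
split=> [x /andP[x0 x1]|a b a0 ab b1|x /andP[x0 x1] d2f].
- by have [L _ [d _]] := G x x x0 (lexx _) x1; apply: d; rewrite lexx.
- by have [L L0 [_ h]] := G a b a0 (ltW ab) b1; exists L.
have p0 : 0 < x * (1 - x) by rewrite mulr_gt0// subr_gt0.
(* Within distance 1/A of [x], the function A t(1 - t) differs from its value K + 1 at [x] by less
   than 1 and so stays above [K]. The Lipschitz constant 2 A then gives the bound 2 (K + 1),
   whatever [x]. *)
pose A := (K + 1) / (x * (1 - x)).
have A0 : 0 < A by rewrite divr_gt0// ltr_pwDr.
pose d := Num.min (Num.min x (1 - x)) A^-1.
have d0 : 0 < d by rewrite !lt_min x0 subr_gt0 x1 invr_gt0.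
have [|||_ h] := @D A (x - d) (x + d) (ltW A0).
- by rewrite subr_ge0 /d !ge_min lexx.
- by rewrite -lerBrDl /d !ge_min lexx orbT.
- move=> t xt.
  have td : `|t - x| < A^-1.
    by apply: (@lt_le_trans _ _ d); [rewrite ltr_norml; lra|rewrite /d ge_min lexx orbT].
  have tx : `|t * (1 - t) - x * (1 - x)| <= `|t - x|.
    have -> : t * (1 - t) - x * (1 - x) = (t - x) * (1 - t - x) by ring.
    rewrite normrM ler_piMr// ler_norml.
    have : d <= x by rewrite /d !ge_min lexx.
    have : d <= 1 - x by rewrite /d !ge_min lexx orbT.
    lra.
  have tA : A * `|t - x| < 1 by rewrite mulrC -ltr_pdivlMr// mul1r.
  have AE : A * (x * (1 - x)) = K + 1 by rewrite /A divfK// gt_eqF.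
  have : A * (x * (1 - x) - t * (1 - t)) <= A * `|t - x|.
    by rewrite ler_pM2l// (le_trans _ tx)// distrC ler_norm.
  rewrite mulrBr AE; lra.
apply: le_trans (_ : (x * (1 - x)) * (2 * A) <= _); last first.
  by rewrite /A le_eqVlt; apply/orP; left; apply/eqP; field; rewrite !gt_eqF ?subr_gt0.
rewrite normrM gtr0_norm// ler_pM2l//.
apply: (@derive1_le_lipschitz _ _ (x - d / 2) (x + d / 2)) => //; first lra.
by move=> y yx; apply: h; lra.
Qed.

(** * Absolutely continuous functions on the line *)

Definition disjoint_itvs (R : realType) (s : seq (R * R)) : bool :=
  all (fun p => p.1 < p.2) s &&
  pairwise (fun p q => (p.2 <= q.1) || (q.2 <= p.1)) s.

(* Absolute continuity on the whole line, with lists of intervals instead of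
   families indexed by ordinals: lists can be refined and concatenated. *)
Definition seqAC (R : realType) (f : R -> R) := forall e : R, 0 < e ->
  exists2 d : R, 0 < d & forall s, disjoint_itvs s ->
    \sum_(p <- s) (p.2 - p.1) < d -> \sum_(p <- s) `|f p.2 - f p.1| < e.

(** Composition with this projection extends a function on [a, b] to the line by constants and
    preserves absolute continuity. *)
Definition clamp (R : realType) (a b x : R) : R := Num.max a (Num.min x b).

Lemma clamp_itv (R : realType) (a b x : R) : a <= b -> a <= clamp a b x <= b.
Proof. by move=> ab; rewrite /clamp le_max lexx/= ge_max ab ge_min lexx orbT. Qed.

Lemma clamp_id (R : realType) (a b x : R) : a <= x <= b -> clamp a b x = x.
Proof. by case/andP=> ax xb; rewrite /clamp min_l// max_r. Qed.

Lemma clamp_dist (R : realType) (a b x y : R) : x <= y ->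
  clamp a b x <= clamp a b y /\ clamp a b y - clamp a b x <= y - x.
Proof.
move=> xy; rewrite /clamp /Order.min.
case: (ltP x b) => h1; case: (ltP y b) => h2; rewrite /Order.max;
  repeat (let h := fresh in case: ltP => h); split; lra.
Qed.

Lemma seqAC_clamp (R : realType) (a b : R) (f : R -> R) : a <= b ->
  absolutely_continuous a b f -> seqAC (f \o clamp a b).
Proof.
move=> ab H e /H[d d0 hd]; exists d => // s /andP[s1 s2] sd.
pose cl (p : R * R) := (clamp a b p.1, clamp a b p.2).
(* Intervals that the projection collapses are dropped: their images have length and increment zero,
   and absolute continuity on [a, b] is stated for u < v. *)
pose t := [seq p <- map cl s | p.1 < p.2].
have t1 : all (fun p => p.1 < p.2) t by exact: filter_all.
have t2 : pairwise (fun p q => (p.2 <= q.1) || (q.2 <= p.1)) t.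
  apply: pairwise_filter; rewrite pairwise_map.
  move: s2; apply: sub_pairwise => p q /= /orP[] /(clamp_dist a b)[-> _] //.
  by rewrite orbT.
have td : \sum_(p <- t) (p.2 - p.1) < d.
  apply: le_lt_trans sd; rewrite big_filter big_map.
  rewrite [leRHS](bigID (fun p => (cl p).1 < (cl p).2))/=.
  rewrite -[leLHS]addr0 lerD//.
    rewrite big_seq_cond [leRHS]big_seq_cond; apply: ler_sum => p /andP[ps _].
    by have [] := clamp_dist a b (ltW (allP s1 p ps)).
  rewrite big_seq_cond; apply: sumr_ge0 => p /andP[ps _].
  by rewrite subr_ge0 ltW// (allP s1).
have -> : \sum_(p <- s) `|(f \o clamp a b) p.2 - (f \o clamp a b) p.1| =
    \sum_(p <- t) `|f p.2 - f p.1|.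
  rewrite [RHS]big_filter big_map [LHS](bigID (fun p => (cl p).1 < (cl p).2))/=.
  rewrite [X in _ + X]big1_seq ?addr0// => p /andP[]; rewrite -leNgt => h ps.
  have [h' _] := clamp_dist a b (ltW (allP s1 p ps)).
  have -> : clamp a b p.2 = clamp a b p.1 by apply/eqP; rewrite eq_le h h'.
  by rewrite subrr normr0.
rewrite (big_nth (0, 0)) big_mkord; apply: hd.
- move=> i; have it : nth (0, 0) t i \in t by rewrite mem_nth.
  have := it; rewrite mem_filter => /andP[ilt /mapP[p ps E]].
  rewrite ilt E/=; have /andP[-> _] := clamp_itv p.1 ab.
  by have /andP[_ ->] := clamp_itv p.2 ab.
- move=> i j _ _ [x []]; rewrite /= !in_itv/= => /andP[h1 h2] /andP[h3 h4].
  apply/eqP; apply: contraT; move/(pairwiseP (0, 0)): t2 => t2.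
  rewrite neq_lt => /orP[ij|ij].
    have /orP[h|h] := t2 i j (ltn_ord i) (ltn_ord j) ij; lra.
  have /orP[h|h] := t2 j i (ltn_ord j) (ltn_ord i) ij; lra.
- by move: td; rewrite (big_nth (0, 0)) big_mkord.
Qed.

Lemma seqACD (R : realType) (f g : R -> R) : seqAC f -> seqAC g -> seqAC (f \+ g).
Proof.
move=> F G e e0; have e2 : 0 < e / 2 by rewrite divr_gt0.
have [d1 d10 h1] := F _ e2; have [d2 d20 h2] := G _ e2.
exists (Num.min d1 d2); first by rewrite lt_min d10.
move=> s sd; rewrite lt_min => /andP[/(h1 _ sd) k1 /(h2 _ sd) k2].
have := ltrD k1 k2; rewrite -splitr; apply: le_lt_trans; rewrite -big_split/=; apply: ler_sum => p _.
by rewrite opprD addrACA ler_normD.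
Qed.

Lemma seqACN (R : realType) (f : R -> R) : seqAC f -> seqAC (\- f).
Proof.
move=> F e /F[d d0 h]; exists d => // s sd /(h _ sd).
by under [X in _ -> X < _]eq_bigr do rewrite /= -opprD normrN.
Qed.

Lemma seqAC_small (R : realType) (f : R -> R) (e : R) : seqAC f -> 0 < e ->
  exists2 d : R, 0 < d & forall x y, `|y - x| < d -> `|f y - f x| < e.
Proof.
move=> F /F[d d0 h]; exists d => // x y.
wlog xy : x y / x < y => [W|].
  have [/W|yx|->] := ltgtP x y; first exact.
    by rewrite distrC [`|f y - _|]distrC; exact: W.
  (* The empty family gives back 0 < e. *)
  have := h [::]; rewrite !big_nil => /(_ isT d0).
  by rewrite !subrr normr0.
rewrite gtr0_norm ?subr_gt0// => yd; have := h [:: (x, y)].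
by rewrite !big_seq1; apply => //; rewrite /disjoint_itvs /= xy.
Qed.

Lemma seqAC_continuous (R : realType) (f : R -> R) : seqAC f -> continuous f.
Proof.
move=> F x; apply/cvgrPdist_lt => e e0; have [d d0 h] := seqAC_small F e0.
by apply: (filterS _ (nbhsx_ballx x d d0)) => y; exact: h.
Qed.

(** * Total variation and the Jordan decomposition *)

Definition pieces (R : realType) (a : R) (s : seq R) : seq (R * R) := zip (a :: s) s.

Lemma pieces_sum (R : realType) (a : R) s :
  \sum_(p <- pieces a s) (p.2 - p.1) = last a s - a.
Proof.
elim: s a => [|y s IH] a /=; first by rewrite big_nil subrr.
by rewrite [pieces _ _]/= big_cons /= IH addrC addrA subrK.
Qed.

Lemma pieces_variation (R : realType) (a b : R) f s : itv_partition a b s ->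
  \sum_(p <- pieces a s) `|f p.2 - f p.1| = variation a b f s.
Proof.
move=> P; rewrite (variation_zip _ P) {P}.
elim: s a => [|y s IH] a; first by rewrite !big_nil.
by rewrite [pieces _ _]/= !big_cons IH.
Qed.

Lemma pieces_in (R : realType) (a : R) s : path <%R a s ->
  a <= last a s /\
  forall p, p \in pieces a s -> [/\ a <= p.1, p.1 < p.2 & p.2 <= last a s].
Proof.
elim: s a => [|y s IH] a //= /andP[ay /IH[yl H]].
split; first exact: le_trans (ltW ay) yl.
move=> p; rewrite inE => /predU1P[->//|/H[h1 h2 h3]].
by split=> //; exact: le_trans (ltW ay) h1.
Qed.

Lemma pieces_disjoint (R : realType) (a : R) s : path <%R a s ->
  disjoint_itvs (pieces a s).
Proof.
elim: s a => [|y s IH] a //= /andP[ay ys].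
have /andP[h1 h2] := IH _ ys; rewrite /disjoint_itvs /= -/(pieces y s) ay h1 h2 !andbT /=.
by apply/allP => p /((pieces_in ys).2 _)[-> _ _].
Qed.

(** Partitioning the intervals leaves their total length unchanged, so the same [d] serves for all
    partitions; passing to the supremum turns [<] into [<=]. *)
Lemma seqAC_total_variation (R : realType) (f : R -> R) (e : R) : seqAC f -> 0 < e ->
  exists2 d : R, 0 < d & forall s, disjoint_itvs s ->
    \sum_(p <- s) (p.2 - p.1) < d ->
    (\sum_(p <- s) total_variation p.1 p.2 f <= e%:E)%E.
Proof.
move=> F /F[d d0 h]; exists d => // s sd slt.
(* The intervals of s are refined one by one and their pieces moved to t. *)
suff : forall t, disjoint_itvs (s ++ t) -> \sum_(p <- s ++ t) (p.2 - p.1) < d ->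
    (\sum_(p <- s) total_variation p.1 p.2 f +
     (\sum_(p <- t) `|f p.2 - f p.1|)%:E <= e%:E)%E.
  by move=> /(_ [::]); rewrite cats0 big_nil adde0; exact.
elim: s {sd slt} => [|p s IH] t td tlt.
  by rewrite big_nil add0e lee_fin ltW// h.
have tp : disjoint_itvs (s ++ t).
  by case/andP: td => /andP[_ h1] /andP[_ h2]; apply/andP.
have plt : p.1 < p.2 by move: td => /andP[/andP[]].
have tplt : \sum_(p <- s ++ t) (p.2 - p.1) < d.
  by apply: le_lt_trans tlt; rewrite /= big_cons lerDr subr_ge0 ltW.
have S0 : (0 <= \sum_(p <- s) total_variation p.1 p.2 f)%E.
  rewrite big_seq; apply: sume_ge0 => q qs; apply: total_variation_ge0.
  move: tp => /andP[/allP/(_ q) + _]; rewrite mem_cat qs => /(_ isT) /ltW.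
  exact.
have t0 : 0 <= \sum_(p <- t) `|f p.2 - f p.1| by exact: sumr_ge0.
(* Finiteness allows moving this sum across an inequality of extended reals. *)
have Sfin : (\sum_(p <- s) total_variation p.1 p.2 f)%E \is a fin_num.
  rewrite ge0_fin_numE//; apply: (@le_lt_trans _ _ e%:E); last exact: ltry.
  by apply: le_trans (IH t tp tplt); rewrite leeDl ?lee_fin.
rewrite big_cons -addeA -leeBrDr; last by rewrite fin_numD Sfin.
apply: ge_ereal_sup => _ [_ [l pl <-] <-].
rewrite leeBrDr; last by rewrite fin_numD Sfin.
rewrite -(pieces_variation _ pl) addeCA -EFinD -big_cat/=.
case: pl => lp /eqP lE.
have [_ pin] := pieces_in lp; have /andP[d1 d2] := pieces_disjoint lp.
apply: IH.
- move: td => /andP[/= /andP[_]]; rewrite all_cat => /andP[k1 k2].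
  rewrite all_cat => /andP[/andP[k3 k4]].
  rewrite pairwise_cat => /and3P[k5 k6 k7].
  rewrite /disjoint_itvs !all_cat k1 d1 k2 !pairwise_cat d2 k6 k7 !andbT/=.
  rewrite allrel_catr k5 andbT; apply/andP; split; apply/allrelP.
    move=> x q xs /pin[h1 h2 h3]; rewrite lE in h3.
    by have /orP[h4|h4] := allP k3 x xs; apply/orP; [right|left]; lra.
  move=> q x /pin[h1 h2 h3] xt; rewrite lE in h3.
  by have /orP[h4|h4] := allP k4 x xt; apply/orP; [left|right]; lra.
- move: tlt; rewrite /= big_cons !big_cat/= pieces_sum lE.
  by rewrite addrCA.
Qed.

(** Intervals shorter than the [d] for e = 1 have variation at most 1; a general interval is
    exhausted by steps of length d/2. *)
Lemma seqAC_tv_fin (R : realType) (f : R -> R) (x y : R) : seqAC f -> x <= y ->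
  total_variation x y f \is a fin_num.
Proof.
move=> F xy; have [d d0 h] := seqAC_total_variation F ltr01.
have small u v : u <= v -> v - u < d -> total_variation u v f \is a fin_num.
  rewrite le_eqVlt => /predU1P[->|uv] vud; first by rewrite total_variationxx.
  rewrite ge0_fin_numE ?total_variation_ge0 ?(ltW uv)//.
  apply: le_lt_trans (ltry 1); have := h [:: (u, v)].
  by rewrite !big_seq1; apply => //; rewrite /disjoint_itvs/= uv.
have [n yxn] : exists n : nat, y - x <= n%:R * (d / 2).
  exists (Num.bound ((y - x) / (d / 2))); rewrite -ler_pdivrMr ?divr_gt0//.
  by rewrite ltW// archi_boundP// divr_ge0 ?subr_ge0// ltW// divr_gt0.
elim: n x y xy yxn => [|n IH] x y xy yxn.
  by apply: small => //; lra.
have [xyd|xyd] := ltP (y - x) d; first exact: small.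
have d2 : x <= x + d / 2 by lra.
have d3 : x + d / 2 <= y by lra.
rewrite (total_variationD f d2 d3) fin_numD small//; last by lra.
by rewrite IH//; move: yxn; rewrite -natr1 mulrDl; lra.
Qed.

(** Counted negatively to the left of [a], so that increments are total variations on the whole
    line. *)
Definition signed_variation (R : realType) (f : R -> R) (a x : R) : R :=
  if a <= x then fine (total_variation a x f)
  else - fine (total_variation x a f).

Lemma signed_variationB (R : realType) (f : R -> R) (a x y : R) : seqAC f ->
  x <= y -> signed_variation f a y - signed_variation f a x =
            fine (total_variation x y f).
Proof.
move=> F xy; have fin := fun u v => @seqAC_tv_fin _ f u v F.
have D u v w : u <= v -> v <= w -> fine (total_variation u w f) =
    fine (total_variation u v f) + fine (total_variation v w f).
  by move=> uv vw; rewrite (total_variationD f uv vw) fineD ?fin.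
rewrite /signed_variation; have [ax|xa] := leP a x.
  by rewrite (le_trans ax xy) (D _ _ _ ax xy); ring.
have [ay|ya] := leP a y; first by rewrite (D _ _ _ (ltW xa) ay); ring.
by rewrite (D _ _ _ xy (ltW ya)); ring.
Qed.

Lemma signed_variation_seqAC (R : realType) (f : R -> R) (a : R) : seqAC f ->
  seqAC (signed_variation f a).
Proof.
(* The bound on total variations is not strict, hence e / 2. *)
move=> F e e0; have e2 : 0 < e / 2 by rewrite divr_gt0.
have [d d0 h] := seqAC_total_variation F e2; exists d => // s sd slt.
apply: (@le_lt_trans _ _ (e / 2)); last by rewrite ltr_pdivrMr// ltr_pMr// ltr1n.
rewrite -lee_fin; apply: le_trans (h s sd slt); rewrite -sumEFin.
rewrite le_eqVlt; apply/orP; left; apply/eqP; rewrite !big_seq.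
apply: eq_bigr => p ps; have /ltW pp : p.1 < p.2.
  by move: sd => /andP[/allP/(_ p ps)].
rewrite signed_variationB// ger0_norm ?fine_ge0 ?total_variation_ge0//.
by rewrite fineK// seqAC_tv_fin.
Qed.

Lemma signed_variation_ge (R : realType) (f : R -> R) (a x y : R) : seqAC f ->
  x <= y -> `|f y - f x| <= signed_variation f a y - signed_variation f a x.
Proof.
move=> F xy; rewrite signed_variationB// -lee_fin fineK ?seqAC_tv_fin//.
exact: total_variation_ge.
Qed.

(** Jordan decomposition: the increments of [f] are dominated by those of its variation T, so T and
    T - f are both nondecreasing. *)
Lemma seqAC_split (R : realType) (f : R -> R) : seqAC f -> exists g h,
  [/\ seqAC g, seqAC h, {homo g : x y / x <= y}, {homo h : x y / x <= y} &
      f = g \- h].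
Proof.
move=> F; pose T := signed_variation f 0.
exists T, (T \- f); split.
- exact: signed_variation_seqAC.
- by apply: seqACD; [exact: signed_variation_seqAC|exact: seqACN].
- move=> x y xy; rewrite -subr_ge0; apply: le_trans (signed_variation_ge 0 F xy).
  exact: normr_ge0.
- move=> x y xy; have := signed_variation_ge 0 F xy; rewrite -/T /= ler_norml.
  by move=> /andP[]; lra.
- by apply/funext => x /=; rewrite subKr.
Qed.

(* The (at most two) intervals making up ]p.1, p.2] minus ]I.1, I.2]. *)
Definition cut (R : realType) (I p : R * R) : seq (R * R) :=
  [seq q <- [:: (p.1, Num.min p.2 I.1); (Num.max p.1 I.2, p.2)] | q.1 < q.2].

(** Intervals are open on the left and closed on the right, as in the semiring from which Stieltjes
    measures are built. *)
Definition in_itvs (R : realType) (s : seq (R * R)) (x : R) : bool :=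
  has (fun p => p.1 < x <= p.2) s.

Lemma cutP (R : realType) (I p q : R * R) : I.1 < I.2 -> q \in cut I p ->
  [/\ p.1 <= q.1, q.1 < q.2, q.2 <= p.2 & (q.2 <= I.1) || (I.2 <= q.1)].
Proof.
move=> I12; rewrite mem_filter !inE => /andP[q12 qE].
case/orP: qE q12 => /eqP-> /=.
  by rewrite lt_min => /andP[h1 h2]; rewrite h1 h2 !ge_min !lexx ?orbT.
by rewrite gt_max => /andP[h1 h2]; rewrite h1 h2 !le_max !lexx ?orbT.
Qed.

Lemma cut_pairwise (R : realType) (I p : R * R) : I.1 < I.2 ->
  pairwise (fun p q => (p.2 <= q.1) || (q.2 <= p.1)) (cut I p).
Proof.
move=> I12; apply: pairwise_filter => /=; rewrite !andbT.
apply/orP; left; rewrite (@le_trans _ _ I.1) ?ge_min ?lexx ?orbT//.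
by rewrite (@le_trans _ _ I.2) ?le_max ?lexx ?orbT// ltW.
Qed.

Lemma cut_sum (R : realType) (I p : R * R) : I.1 < I.2 -> p.1 < p.2 ->
  \sum_(q <- cut I p) (q.2 - q.1) <= p.2 - p.1.
Proof.
move=> I12 p12; rewrite big_filter !big_cons big_nil /=.
rewrite /Order.min /Order.max; case: (ltP p.2 I.1) => h1; case: (ltP p.1 I.2) => h2.
all: by case: ifP => h3; case: ifP => h4; lra.
Qed.

Lemma cut_cover (R : realType) (I p : R * R) x : p.1 < x <= p.2 ->
  (I.1 < x <= I.2) || in_itvs (cut I p) x.
Proof.
move=> /andP[px xp]; have [Ix|xI] := ltP I.1 x; last first.
  apply/orP; right; apply/hasP; exists (p.1, Num.min p.2 I.1) => /=.
    by rewrite mem_filter inE eqxx /= andbT lt_min (lt_le_trans px xp) (lt_le_trans px xI).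
  by rewrite px le_min xp.
have [xI|Ix2] := leP x I.2 => //=.
apply/hasP; exists (Num.max p.1 I.2, p.2) => /=; last by rewrite gt_max px Ix2.
by rewrite mem_filter !inE eqxx orbT andbT /= gt_max (lt_le_trans px xp) (lt_le_trans Ix2 xp).
Qed.

(** [I] is kept whole and cut out of the family obtained for the rest. Lengths are truncated at 0
    because a covering family may contain empty intervals. *)
Lemma disjointify (R : realType) (s : seq (R * R)) : exists t,
  [/\ disjoint_itvs t,
      \sum_(p <- t) (p.2 - p.1) <= \sum_(p <- s) Num.max 0 (p.2 - p.1) &
      forall x, in_itvs s x -> in_itvs t x].
Proof.
elim: s => [|I s [t [td tlt tx]]]; first by exists [::]; rewrite !big_nil.
have [I21|I12] := leP I.2 I.1.
  exists t; split => //.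
    by rewrite big_cons (le_trans tlt)// lerDr le_max lexx.
  by move=> x /orP[/andP[h1 h2]|/tx//]; lra.
exists (I :: flatten (map (cut I) t)).
have {}tlt : \sum_(p <- flatten (map (cut I) t)) (p.2 - p.1) <=
    \sum_(p <- s) Num.max 0 (p.2 - p.1).
  apply: le_trans tlt; rewrite big_flatten/= big_map !big_seq.
  apply: ler_sum => p pt; apply: cut_sum => //.
  by move: td => /andP[/allP/(_ _ pt)].
have tin q : q \in flatten (map (cut I) t) -> exists2 p, p \in t & q \in cut I p.
  by move=> /flatten_mapP.
split.
- rewrite /disjoint_itvs/= I12/=; apply/and3P; split.
  + by apply/allP => q /tin[p _ /(cutP I12)[]].
  + apply/allP => q /tin[p _ /(cutP I12)[_ _ _]]; by rewrite orbC.
  + move: td => /andP[_]; elim: t {tlt tx tin} => //= p t IH /andP[pt /IH ht].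
    rewrite pairwise_cat ht cut_pairwise// !andbT.
    apply/allrelP => q q' /(cutP I12)[h1 h2 h3 _] /flatten_mapP[p' p't].
    move=> /(cutP I12)[h4 h5 h6 _].
    by have /orP[h|h] := allP pt _ p't; apply/orP; [left|right]; lra.
- by rewrite !big_cons lerD// le_max lexx orbT.
- move=> x; rewrite /in_itvs/= => /orP[->//|/tx /hasP[p pt /(cut_cover I)]].
  move=> /orP[->//|/hasP[q qp qx]]; apply/orP; right; apply/hasP; exists q => //.
  by apply/flatten_mapP; exists p.
Qed.

(** * Differentiation of absolutely continuous functions *)

Lemma lebesgue_stieltjes_oc (R : realType) (G : cumulative R R) (x y : R) :
  x <= y -> lebesgue_stieltjes_measure G `]x, y]%classic = (G y - G x)%:E.
Proof.
move=> xy; rewrite /lebesgue_stieltjes_measure /measure_extension.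
rewrite measurable_mu_extE /=; first exact: wlength_itv_bnd.
exact: is_ocitv.
Qed.

Lemma lebesgue_stieltjes_itvs (R : realType) (G : cumulative R R) (t : seq (R * R)) :
  all (fun p => p.1 < p.2) t ->
  (lebesgue_stieltjes_measure G [set x | in_itvs t x] <=
    (\sum_(p <- t) `|G p.2 - G p.1|)%:E)%E /\ measurable [set x | in_itvs t x].
Proof.
elim: t => [_|p t IH /= /andP[plt /IH[h mt]]].
  have -> : [set x : R | in_itvs [::] x] = set0 by apply/seteqP; split.
  by rewrite measure0 big_nil; split => //; exact: measurable0.
have -> : [set x | in_itvs (p :: t) x] = `]p.1, p.2]%classic `|` [set x | in_itvs t x].
  apply/seteqP; split => x; rewrite /in_itvs /= in_itv/=.
    by move=> /orP[]; [left|right].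
  by move=> [->//|->]; rewrite orbT.
have mp : measurable (`]p.1, p.2]%classic : set (measurableTypeR R)).
  exact: measurable_itv.
split; last exact: measurableU.
apply: le_trans (measureU2 _ mp mt) _.
rewrite big_cons EFinD; apply: leeD => //.
rewrite [leLHS](lebesgue_stieltjes_oc G (ltW plt)) lee_fin.
exact: ler_norm.
Qed.

(** A null set has a countable cover of total length below the [d] of absolute continuity. Finite
    subfamilies, made disjoint, have Stieltjes measure at most [e], and continuity from below
    extends this to the whole cover. *)
Lemma seqAC_dominated (R : realType) (G : cumulative R R) : seqAC G ->
  lebesgue_stieltjes_measure G `<< @lebesgue_measure R.
Proof.
move=> F; apply/null_content_dominatesP => A mA A0.
apply/eqP; rewrite eq_le measure_ge0 andbT.
apply/lee_addgt0Pr => e e0; rewrite add0e.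
have [d d0 hd] := F e e0.
have : (lebesgue_measure A < d%:E)%E by rewrite A0 lte_fin.
(* Lebesgue measure is constructed as an infimum over countable covers by intervals ]u, v]. *)
move=> /ereal_inf_lt[_ [B [mB AB] <-] Blt].
have {}mB k : exists p : R * R, B k = `]p.1, p.2]%classic.
  by have [p _ <-] := mB k; exists p.
have [p Bp] := choice mB.
pose U n := [set x | in_itvs (map p (iota 0 n)) x].
have UE : \bigcup_k B k = \bigcup_n U n.
  apply/seteqP; split => x [k _].
    rewrite Bp /= in_itv/= => xk; exists k.+1 => //.
    by apply/hasP; exists (p k) => //; rewrite map_f// mem_iota/= ltnS.
  by move=> /hasP[q /mapP[j _ ->] xq]; exists j => //; rewrite Bp/= in_itv.
have mU n : measurable (U n : set (measurableTypeR R)).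
  rewrite (_ : U n = \big[setU/set0]_(k < n) B k).
    by apply: bigsetU_measurable => k _; rewrite Bp; exact: measurable_itv.
  rewrite -bigcup_mkord; apply/seteqP; split => x.
    move=> /hasP[q /mapP[j + ->] xq]; rewrite mem_iota => jn.
    by exists j => //; rewrite Bp/= in_itv.
  move=> [j /= jn]; rewrite Bp/= in_itv/= => xj.
  by apply/hasP; exists (p j) => //; rewrite map_f// mem_iota.
have Ule n : (lebesgue_stieltjes_measure G (U n) <= e%:E)%E.
  have [t [td tlt tU]] := disjointify (map p (iota 0 n)).
  have /andP[t1 _] := td.
  have [Gt mt] := lebesgue_stieltjes_itvs G t1.
  apply: (@le_trans _ _ (lebesgue_stieltjes_measure G [set x | in_itvs t x])).
    apply: le_measure; rewrite ?inE//; exact: tU.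
  apply: le_trans Gt _; rewrite lee_fin ltW// hd//.
  rewrite -lte_fin; apply: le_lt_trans Blt.
  apply: le_trans (nneseries_lim_ge n _) => //.
  rewrite -lee_fin in tlt; apply: le_trans tlt _.
  rewrite big_map -sumEFin /index_iota subn0; apply: lee_sum => k _.
  rewrite Bp; have [lt|le] := ltP (p k).1 (p k).2.
    by rewrite [leRHS](wlength_itv_bnd _ _ _ (ltW lt)) lee_fin ge_max lexx subr_ge0 ltW.
  rewrite set_itv_ge ?bnd_simp -?leNgt// [leRHS]wlength0 lee_fin ge_max lexx.
  by rewrite subr_le0.
have mUU : measurable (\bigcup_n U n : set (measurableTypeR R)).
  exact: bigcupT_measurable.
apply: (@le_trans _ _ (lebesgue_stieltjes_measure G (\bigcup_n U n))).
  by apply: le_measure; rewrite ?inE// -UE.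
have ndU : nondecreasing_seq U.
  move=> n m nm; apply/subsetPset => x /hasP[q qn xq]; apply/hasP; exists q => //.
  move: qn => /mapP[k]; rewrite mem_iota => /andP[_ kn] ->.
  by rewrite map_f// mem_iota/=; exact: leq_trans kn _.
have cv := @nondecreasing_cvg_mu _ _ R (lebesgue_stieltjes_measure G) U mU mUU ndU.
rewrite -(cvg_lim _ cv)//; apply: lime_le; last exact: nearW.
by apply/cvg_ex; eexists; exact: cv.
Qed.

Lemma seqAC_nondecreasing_density (R : realType) (G : R -> R) (a b : R) :
  seqAC G -> {homo G : x y / x <= y} -> a <= b ->
  exists2 h : R -> R, (@lebesgue_measure R).-integrable setT (EFin \o h) &
    forall x, a <= x <= b ->
      G x - G a = (\int[lebesgue_measure]_(t in `[a, x]) h t)%R.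
Proof.
move=> F ndG ab; have cG := seqAC_continuous F.
pose Gc : cumulative R R := HB.pack G (isCumulative.Build R _ R G ndG (right_continuousW cG)).
pose nu := lebesgue_stieltjes_measure Gc.
have nuE : nu `]a, b]%classic = (G b - G a)%:E by exact: lebesgue_stieltjes_oc.
have mab : measurable (`]a, b]%classic : set (measurableTypeR R)) by exact: measurable_itv.
have nuoo : (nu `]a, b]%classic < +oo)%E by rewrite nuE ltry.
(* Restriction to ]a, b] gives a finite measure; [a, x] then has the mass of ]a, x], that is G x - G
   a. *)
pose nu' := mfrestr mab nuoo.
have dom : nu' `<< @lebesgue_measure R.
  apply/null_content_dominatesP => A mA A0; rewrite /nu' /mfrestr /mrestr.
  have /null_content_dominatesP := @seqAC_dominated _ Gc F; apply.
    exact: measurableI.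
  apply/eqP; rewrite -measure_le0 -[leRHS]A0.
  by apply: le_measure; rewrite ?inE//; exact: measurableI.
have [h [h0 hfin hint hE]] := radon_nikodym_sigma_finite dom.
exists (fine \o h).
  by apply: eq_integrable hint => // x _ /=; rewrite fineK.
move=> x /andP[ax xb].
have nuE' : nu' `[a, x]%classic = (G x - G a)%:E.
  rewrite /nu' /mfrestr /mrestr -[RHS](@lebesgue_stieltjes_oc _ Gc)//; congr (lebesgue_stieltjes_measure _ _).
  apply/seteqP; split => y /=; rewrite !in_itv/=.
    by move=> [/andP[_ ->]/andP[-> _]].
  by move=> /andP[ay yx]; rewrite (ltW ay) yx ay (le_trans yx xb).
have := hE _ (measurable_itv `[a, x]); rewrite [LHS]nuE' => H.
rewrite /Rintegral; under eq_integral do rewrite /= fineK//.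
by rewrite -H.
Qed.

Lemma seqAC_density (R : realType) (f : R -> R) (a b : R) :
  seqAC f -> a <= b ->
  exists2 h : R -> R, (@lebesgue_measure R).-integrable setT (EFin \o h) &
    forall x, a <= x <= b ->
      f x - f a = (\int[lebesgue_measure]_(t in `[a, x]) h t)%R.
Proof.
move=> /seqAC_split[g1 [g2 [F1 F2 n1 n2 ->]]] ab.
have [h1 i1 E1] := seqAC_nondecreasing_density F1 n1 ab.
have [h2 i2 E2] := seqAC_nondecreasing_density F2 n2 ab.
exists (h1 \- h2).
  have := integrableB measurableT i1 i2.
  by apply: eq_integrable => // x _ /=.
move=> x xab /=; rewrite RintegralB//.
- by rewrite -E1// -E2//; ring.
- by apply: integrableS i1 => //; exact: measurable_itv.
- by apply: integrableS i2 => //; exact: measurable_itv.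
Qed.

Lemma near_eq_derive1 (R : realType) (f g : R -> R) x :
  (\near x, f x = g x) -> derive1 f x = derive1 g x.
Proof. by move=> fg; rewrite !derive1E; exact: near_eq_derive. Qed.

Lemma seqAC_ftc (R : realType) (f : R -> R) (a b : R) :
  seqAC f -> a <= b ->
  exists h : R -> R, [/\ (@lebesgue_measure R).-integrable setT (EFin \o h),
    forall x, a <= x <= b ->
      f x - f a = (\int[lebesgue_measure]_(t in `[a, x]) h t)%R &
    {ae (@lebesgue_measure R), forall x, a < x < b ->
       derivable f x 1 /\ derive1 f x = h x}].
Proof.
move=> F ab; have [h hi hE] := seqAC_density F ab; exists h; split => //.
have loc : locally_integrable [set: R] h.
  by apply: open_integrable_locally => //; exact: openT.
have hi' y : (@lebesgue_measure R).-integrable [set` Interval (BLeft a) (BRight y)] (EFin \o h).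
  by apply: integrableS hi => //; exact: measurable_itv.
have := FTC1 hi' loc.
apply: filterS; first exact: (ae_filter_ringOfSetsType (@lebesgue_measure R)).
move=> x H /andP[ax xb].
have [|dx dE] := H; first by rewrite /= ?lte_fin ?bnd_simp ?ltW.
(* Near an interior point [f] is a constant plus the indefinite integral of [h]. *)
pose G y := f a + (\int[lebesgue_measure]_(t in `[a, y]) h t)%R.
have fG : \near x, G x = f x.
  near=> y; rewrite /G -hE; first by ring.
  apply/andP; split; apply: ltW; near: y.
    exact: lt_nbhsr.
  exact: lt_nbhsl.
have dG : is_derive x 1 G (h x).
  have dI : is_derive x 1 (fun y => (\int[lebesgue_measure]_(t in `[a, y]) h t)%R) (h x).
    by split; [exact: dx|rewrite -derive1E].
  by rewrite -[h x]add0r; exact: (is_deriveD (is_derive_cst _ _ _) dI).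
have [df <-] := near_eq_is_derive fG dG.
by rewrite derive1E.
Unshelve. all: by end_near. Qed.

Lemma ae_neq (R : realType) (a : R) :
  {ae (@lebesgue_measure R), forall x, x != a}.
Proof.
exists [set a]; split; [exact: measurable_set1|exact: lebesgue_measure_set1|].
by move=> x /= /negP; rewrite negbK => /eqP.
Qed.

Lemma near_itv (R : realType) (a b x : R) : a < x < b -> \near x, a < x < b.
Proof.
move=> /andP[ax xb]; near=> y; apply/andP; split; near: y.
  exact: lt_nbhsr.
exact: lt_nbhsl.
Unshelve. all: by end_near. Qed.

Lemma clamp_near (R : realType) (a b x : R) (f : R -> R) : a < x < b ->
  \near x, (f \o clamp a b) x = f x.
Proof.
move=> /near_itv; apply: filterS => y /andP[ay yb] /=.
by rewrite clamp_id// (ltW ay) (ltW yb).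
Qed.

Lemma AC_ae_derivable (R : realType) (g : R -> R) (a b : R) : a <= b ->
  absolutely_continuous a b g ->
  {ae (@lebesgue_measure R), forall x, a < x < b -> derivable g x 1}.
Proof.
move=> ab /(seqAC_clamp ab) /seqAC_ftc/(_ ab)[h [_ _]].
apply: filterS; first exact: (ae_filter_ringOfSetsType (@lebesgue_measure R)).
move=> x H /[dup] xab /H[dg _]; apply: near_eq_derivable dg.
exact: clamp_near.
Qed.

(** The increment is the integral of the derivative, whose sign is known almost everywhere.
    Continuity would not do: minus the Cantor function is a counterexample. *)
Lemma AC_nondecreasing (R : realType) (g : R -> R) (a b : R) : a <= b ->
  absolutely_continuous a b g ->
  {ae (@lebesgue_measure R), forall x, a < x < b -> derivable g x 1 ->
     0 <= derive1 g x} -> g a <= g b.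
Proof.
move=> ab /(seqAC_clamp ab) /seqAC_ftc/(_ ab)[h [hi hE hd]] g'0.
have := hE b; rewrite lexx ab => /(_ isT) /=.
rewrite !clamp_id ?lexx ?ab// => gE.
rewrite -subr_ge0 gE.
have mab : measurable (`[a, b]%classic : set (measurableTypeR R)).
  exact: measurable_itv.
have /integrableP[mh _] : (@lebesgue_measure R).-integrable `[a, b] (EFin \o h).
  by apply: integrableS hi.
(* [h] equals its absolute value almost everywhere; the end points, where nothing is known, form a
   null set. *)
have -> : (\int[lebesgue_measure]_(t in `[a, b]) h t)%R =
    (\int[lebesgue_measure]_(t in `[a, b]) `|h t|)%R; last first.
  by apply: Rintegral_ge0 => x _.
congr fine; apply: ae_eq_integral => //.
  by apply/measurable_EFinP; apply: measurableT_comp => //; exact/measurable_EFinP.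
have flt := ae_filter_ringOfSetsType (@lebesgue_measure R).
have := @filterI _ _ flt _ _ (@filterI _ _ flt _ _ hd g'0)
  (@filterI _ _ flt _ _ (ae_neq a) (ae_neq b)).
apply: filterS => x [[hdx g0x] [xa xb]] /=; rewrite in_itv/= => /andP[ax xb'].
have xab : a < x < b by rewrite !lt_neqAle ax xb' xb eq_sym xa.
have [dx <-] := hdx xab; congr (_%:E); rewrite ger0_norm//.
rewrite (near_eq_derive1 (clamp_near g xab)); apply: g0x => //.
by apply: near_eq_derivable dx; exact: clamp_near.
Qed.

(** * From a bounded second derivative to the Bernstein rate *)

Lemma absolutely_continuousD (R : realType) (a b : R) (f g : R -> R) :
  absolutely_continuous a b f -> absolutely_continuous a b g ->
  absolutely_continuous a b (f \+ g).
Proof.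
move=> F G e e0; have e2 : 0 < e / 2 by rewrite divr_gt0.
have [d1 d10 h1] := F _ e2; have [d2 d20 h2] := G _ e2.
exists (Num.min d1 d2); first by rewrite lt_min d10.
move=> n u v uv tuv; rewrite lt_min => /andP[/(h1 n u v uv tuv) k1 /(h2 n u v uv tuv) k2].
have := ltrD k1 k2; rewrite -splitr; apply: le_lt_trans; rewrite -big_split/=.
by apply: ler_sum => i _; rewrite opprD addrACA ler_normD.
Qed.

Lemma absolutely_continuous_le (R : realType) (a b : R) (f g : R -> R) :
  (forall x y, a <= x -> x < y -> y <= b -> `|f y - f x| <= `|g y - g x|) ->
  absolutely_continuous a b g -> absolutely_continuous a b f.
Proof.
move=> fg G e /G[d d0 h]; exists d => // n u v uv tuv uvd.
apply: le_lt_trans (h n u v uv tuv uvd); apply: ler_sum => i _.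
by have [au uvi vb] := uv i; exact: fg.
Qed.

Lemma absolutely_continuousZ (R : realType) (a b c : R) (f : R -> R) :
  absolutely_continuous a b f -> absolutely_continuous a b (fun x => c * f x).
Proof.
move=> F e e0; have c0 : 0 < `|c| + 1 by rewrite ltr_wpDl.
have [d d0 h] := F _ (divr_gt0 e0 c0); exists d => // n u v uv tuv uvd.
have := h n u v uv tuv uvd; rewrite ltr_pdivlMr//; apply: le_lt_trans.
rewrite mulr_suml; apply: ler_sum => i _.
by rewrite -mulrBr normrM mulrC ler_wpM2l// lerDl.
Qed.

Lemma absolutely_continuous_lipschitz (R : realType) (a b L : R) (f : R -> R) :
  (forall x y, a <= x -> x < y -> y <= b -> `|f y - f x| <= L * (y - x)) ->
  absolutely_continuous a b f.
Proof.
move=> H e e0; exists (e / (`|L| + 1)).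
  by rewrite divr_gt0// ltr_wpDl.
move=> n u v uv _; rewrite ltr_pdivlMr ?ltr_wpDl// => uvd.
apply: le_lt_trans uvd; rewrite mulr_suml; apply: ler_sum => i _.
have [au uvi vb] := uv i; apply: le_trans (H _ _ au uvi vb) _.
rewrite mulrC ler_wpM2l ?subr_ge0 ?(ltW uvi)//.
by rewrite (le_trans (ler_norm L))// lerDl.
Qed.

(** * Logit and entropy as comparison functions *)

(** An antiderivative of 1/(x(1 - x)), the function that bounds |g'| up to a factor when x(1 - x) g'
    is bounded; [neg_entropy] is in turn an antiderivative of it. *)
Definition logit (R : realType) (x : R) : R := ln x - ln (1 - x).

Definition neg_entropy (R : realType) (x : R) : R := x * ln x + (1 - x) * ln (1 - x).

Lemma is_derive_ln1B (R : realType) (x : R) : x < 1 ->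
  is_derive x 1 (fun y => ln (1 - y)) (- (1 - x)^-1).
Proof.
move=> x1; have x10 : 0 < 1 - x by rewrite subr_gt0.
have -> : - (1 - x)^-1 = (1 - x)^-1 * (0 - 1) by rewrite sub0r mulrN1.
apply: (@is_derive1_comp R (@ln R) (fun y => 1 - y)).
exact: is_derive1_ln.
Qed.

Lemma is_derive_logit (R : realType) (x : R) : 0 < x < 1 ->
  is_derive x 1 (@logit R) (x * (1 - x))^-1.
Proof.
move=> /andP[x0 x1]; have -> : (x * (1 - x))^-1 = x^-1 - - (1 - x)^-1.
  by field; rewrite subr_eq0 !gt_eqF.
apply: is_deriveB; [exact: is_derive1_ln|exact: is_derive_ln1B].
Qed.

Lemma is_derive_neg_entropy (R : realType) (x : R) : 0 < x < 1 ->
  is_derive x 1 (@neg_entropy R) (logit x).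
Proof.
move=> /andP[x0 x1]; have x10 : 1 - x != 0 by rewrite subr_eq0 gt_eqF.
have d1 := is_derive1_ln x0; have d2 := is_derive_ln1B x1.
rewrite /neg_entropy; apply: is_derive_eq.
by rewrite /logit /GRing.scale/=; field; rewrite x10 gt_eqF.
Qed.

Lemma ln_le_subr1 (R : realType) (x : R) : 0 < x -> ln x <= x - 1.
Proof.
move=> x0; rewrite -[X in ln X](subrKC 1).
by apply: le_ln1Dx; rewrite ltrBrDl subrr.
Qed.

Lemma ln_div_le (R : realType) (x y : R) : 0 < x -> 0 < y ->
  ln y - ln x <= y / x - 1.
Proof. by move=> x0 y0; rewrite -ln_div ?posrE// ln_le_subr1// divr_gt0. Qed.

(* The Kullback-Leibler divergence is at most the chi-square divergence. *)
Lemma neg_entropy_taylor (R : realType) (x t : R) : 0 < x < 1 -> 0 < t < 1 ->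
  neg_entropy t - neg_entropy x - logit x * (t - x) <= (t - x) ^+ 2 / (x * (1 - x)).
Proof.
move=> /andP[x0 x1] /andP[t0 t1].
have x10 : 0 < 1 - x by rewrite subr_gt0.
have t10 : 0 < 1 - t by rewrite subr_gt0.
have h1 : t * (ln t - ln x) <= t * (t / x - 1).
  by rewrite ler_wpM2l ?ln_div_le// ltW.
have h2 : (1 - t) * (ln (1 - t) - ln (1 - x)) <= (1 - t) * ((1 - t) / (1 - x) - 1).
  by rewrite ler_wpM2l ?ln_div_le// ltW.
have -> : (t - x) ^+ 2 / (x * (1 - x)) =
    t * (t / x - 1) + (1 - t) * ((1 - t) / (1 - x) - 1).
  by field; rewrite !gt_eqF.
by rewrite /neg_entropy /logit; lra.
Qed.

Lemma logit_AC (R : realType) (a b : R) : 0 < a -> b < 1 ->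
  absolutely_continuous a b (@logit R).
Proof.
move=> a0 b1; have b10 : 0 < 1 - b by rewrite subr_gt0.
apply: (@absolutely_continuous_lipschitz _ _ _ (a^-1 + (1 - b)^-1)) => x y ax xy yb.
have x0 : 0 < x := lt_le_trans a0 ax.
have y1 : 0 < 1 - y by rewrite subr_gt0 (le_lt_trans yb).
have y0 : 0 < y := lt_trans x0 xy.
have x1 : 0 < 1 - x by lra.
have h1 : ln x <= ln y by rewrite ler_ln ?posrE// ltW.
have h2 : ln (1 - y) <= ln (1 - x) by rewrite ler_ln ?posrE//; lra.
rewrite /logit ger0_norm; last by lra.
have h3 : ln y - ln x <= a^-1 * (y - x).
  apply: le_trans (ln_div_le x0 y0) _.
  have -> : y / x - 1 = x^-1 * (y - x) by field; rewrite gt_eqF.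
  by rewrite ler_wpM2r ?subr_ge0 ?(ltW xy)// lef_pV2 ?posrE.
have h4 : ln (1 - x) - ln (1 - y) <= (1 - b)^-1 * (y - x).
  apply: le_trans (ln_div_le y1 x1) _.
  have -> : (1 - x) / (1 - y) - 1 = (1 - y)^-1 * (y - x) by field; rewrite gt_eqF.
  by rewrite ler_wpM2r ?subr_ge0 ?(ltW xy)// lef_pV2 ?posrE// lerB.
lra.
Qed.

(** M logit + g and M logit - g have nonnegative derivatives almost everywhere, hence are
    nondecreasing; an [s] with s^2 = 1 carries the sign. *)
Lemma logit_dist (R : realType) (M : R) (g : R -> R) :
  (forall a b, 0 < a -> a < b -> b < 1 -> absolutely_continuous a b g) ->
  {ae (@lebesgue_measure R), forall x, 0 < x < 1 -> derivable g x 1 ->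
    `|x * (1 - x) * derive1 g x| <= M} ->
  forall x y, 0 < x -> x <= y -> y < 1 -> `|g y - g x| <= M * (logit y - logit x).
Proof.
move=> gAC gM x y x0 xy y1.
have [->|xy'] := eqVneq x y; first by rewrite !subrr normr0 mulr0.
have {}xy' : x < y by rewrite lt_neqAle xy'.
have H (s : R) : s ^+ 2 = 1 -> M * logit x + s * g x <= M * logit y + s * g y.
  move=> s1; have s1' : `|s| = 1.
    by apply/eqP; rewrite -(@eqrXn2 _ 2)// real_normK ?num_real// s1 expr1n.
  apply: (@AC_nondecreasing _ (fun t => M * logit t + s * g t)) => //.
    apply: absolutely_continuousD; apply: absolutely_continuousZ.
      exact: logit_AC.
    exact: gAC.
  move: gM; apply: filterS; first exact: (ae_filter_ringOfSetsType (@lebesgue_measure R)).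
  move=> t ht /andP[xt ty] dh.
  have t01 : 0 < t < 1 by rewrite (lt_trans x0 xt) (lt_trans ty y1).
  have dl := is_derive_logit t01.
  have dg : derivable g t 1.
    (* Only M logit + s g is known to be derivable at [t]; multiplication by [s] recovers [g]. *)
    have -> : g = (fun z => s * (M * logit z + s * g z - M * logit z)).
      by apply/funext => z; rewrite addrAC subrr add0r mulrA -expr2 s1 mul1r.
    apply: derivableM; first exact: derivable_cst.
    apply: derivableB; first exact: dh.
    by apply: derivableM; [exact: derivable_cst|exact: ex_derive].
  have dgd : is_derive t 1 g (derive1 g t) by rewrite derive1E; exact: DeriveDef.
  have dM : is_derive t 1 (fun t => M * logit t + s * g t)
      (M *: (t * (1 - t))^-1 + s *: derive1 g t).
    exact: is_deriveD.
  rewrite derive1E (@derive_val _ _ _ _ _ _ _ dM) /GRing.scale/=.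
  have p0 : 0 < t * (1 - t) by case/andP: t01 => t0 t1; rewrite mulr_gt0// subr_gt0.
  have /andP[h _] : - M <= s * (t * (1 - t) * derive1 g t) <= M.
    by rewrite -ler_norml normrM s1' mul1r ht.
  rewrite -(ler_pM2l p0) mulr0 mulrDr.
  have -> : t * (1 - t) * (M / (t * (1 - t))) = M by rewrite mulrC divfK ?gt_eqF.
  lra.
have h1 := H 1 (expr1n _ _); have h2 := H (- 1) (sqrr_sign R 1).
rewrite ler_norml; lra.
Qed.

Lemma derive_within_continuous (R : realType) (a b : R) (f df : R -> R) :
  (forall x, a <= x <= b -> is_derive x 1 f (df x)) ->
  {within `[a, b], continuous f}.
Proof.
move=> H; apply: derivable_within_continuous => x; rewrite in_itv/= => xab.
by have [] := H x xab.
Qed.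

Lemma min_of_derive_sign (R : realType) (D d : R -> R) (x t : R) :
  0 < x < 1 -> 0 < t < 1 ->
  (forall y : R, 0 < y < 1 -> is_derive y 1 D (d y)) ->
  (forall y : R, 0 < y < 1 -> x <= y -> 0 <= d y) ->
  (forall y : R, 0 < y < 1 -> y <= x -> d y <= 0) -> D x <= D t.
Proof.
move=> x01 t01 dD dp dn; have [xt|tx|->//] := ltgtP x t.
- have [| |c] := @MVT _ D d x t xt.
  + by move=> y; rewrite in_itv/= => yxt; apply: dD; lra.
  + by apply: derive_within_continuous => y yxt; apply: dD; lra.
  rewrite in_itv/= => cxt E; rewrite -subr_ge0 E mulr_ge0//; last by lra.
  by apply: dp; lra.
- have [| |c] := @MVT _ D d t x tx.
  + by move=> y; rewrite in_itv/= => yxt; apply: dD; lra.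
  + by apply: derive_within_continuous => y yxt; apply: dD; lra.
  rewrite in_itv/= => cxt E; rewrite -subr_le0 E mulr_le0_ge0//; last by lra.
  by apply: dn; lra.
Qed.

Lemma taylor_of_logit_dist (R : realType) (M : R) (f : R -> R) : 0 <= M ->
  (forall x : R, 0 < x < 1 -> derivable f x 1) ->
  (forall x y, 0 < x -> x <= y -> y < 1 ->
     `|derive1 f y - derive1 f x| <= M * (logit y - logit x)) ->
  forall x t, 0 < x < 1 -> 0 < t < 1 ->
    `|f t - f x - derive1 f x * (t - x)| <= M * (t - x) ^+ 2 / (x * (1 - x)).
Proof.
move=> M0 df H x t x01 t01.
have fd (y : R) : 0 < y < 1 -> is_derive y 1 f (derive1 f y).
  by move=> y01; rewrite derive1E; apply: DeriveDef => //; exact: df.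
have K (s : R) : `|s| <= 1 ->
    s * (f t - f x - derive1 f x * (t - x)) <= M * (t - x) ^+ 2 / (x * (1 - x)).
  move=> s1.
  have Hs y z : 0 < y -> y <= z -> z < 1 ->
      s * (derive1 f z - derive1 f y) <= M * (logit z - logit y).
    move=> y0 yz z1; apply: le_trans (H y z y0 yz z1).
    by rewrite (le_trans (ler_norm _))// normrM ler_piMl.
  rewrite -mulrA; apply: le_trans (ler_wpM2l M0 (neg_entropy_taylor x01 t01)).
  (* Up to a constant, [D] is M times the Taylor remainder of [neg_entropy] at [x] minus s times
     that of [f]. Its derivative [d] has the sign of y - x, so [D] is minimal at [x]. *)
  pose D y := M * (neg_entropy y - logit x * y) - s * (f y - derive1 f x * y).
  pose d y := M * (logit y - logit x) - s * (derive1 f y - derive1 f x).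
  suff : D x <= D t by rewrite /D; lra.
  apply: (@min_of_derive_sign _ D d) => //.
  - move=> y y01; have h1 := is_derive_neg_entropy y01; have h2 := fd y y01.
    apply: is_derive_eq; rewrite /GRing.scale/= /d; ring.
  - move=> y y01 xy; rewrite /d subr_ge0; apply: Hs => //; lra.
  - move=> y y01 yx; rewrite /d.
    have : s * (derive1 f x - derive1 f y) <= M * (logit x - logit y).
      by apply: Hs => //; lra.
    lra.
have := K 1; rewrite normr1 => /(_ (lexx _)).
have := K (- 1); rewrite normrN1 => /(_ (lexx _)).
by rewrite ler_norml; lra.
Qed.

(** The minimum over [0, 1] is attained; were it negative at an end point, it would be so at
    interior points nearby. *)
Lemma le_within01 (R : realType) (G : R -> R) :
  {within `[0, 1], continuous G} ->
  (forall t, 0 < t < 1 -> 0 <= G t) -> forall t, 0 <= t <= 1 -> 0 <= G t.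
Proof.
move=> cG G0 t t01; have [c cin Gc] := EVT_min ler01 cG.
suff : 0 <= G c by move=> h; apply: le_trans h (Gc t _); rewrite in_itv.
rewrite leNgt; apply/negP => Gc0.
have /(continuous_within_itvP _ ltr01)[_ cr cl] := cG.
rewrite in_itv/= in cin; have [c0|c0] := eqVneq c 0.
  have : \forall x \near 0^'+, G x < 0.
    by rewrite c0 in Gc0; exact: (cvgr_lt _ cr).
  move=> N; have : \forall x \near (0 : R)^'+, G x < 0 /\ 0 < x < 1.
    near=> x; split; first by near: x.
    by apply/andP; split; near: x; [exact: nbhs_right_gt|exact: nbhs_right_lt].
  by move=> h; have [x [Gx x01]] := @filter_ex _ _ (at_right_proper_filter (0 : R)) _ h; have := G0 x x01; rewrite leNgt Gx.
have [c1|c1] := eqVneq c 1.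
  have : \forall x \near 1^'-, G x < 0.
    by rewrite c1 in Gc0; exact: (cvgr_lt _ cl).
  move=> N; have : \forall x \near (1 : R)^'-, G x < 0 /\ 0 < x < 1.
    near=> x; split; first by near: x.
    by apply/andP; split; near: x; [exact: nbhs_left_gt|exact: nbhs_left_lt].
  by move=> h; have [x [Gx x01]] := @filter_ex _ _ (at_left_proper_filter (1 : R)) _ h; have := G0 x x01; rewrite leNgt Gx.
have := G0 c; rewrite !lt_neqAle eq_sym c0 c1 => /(_ cin).
by rewrite leNgt Gc0.
Unshelve. all: by end_near. Qed.

(** The Bernstein nodes include 0 and 1, which the Taylor estimate reaches only by continuity. *)
Lemma taylor_closed (R : realType) (f : R -> R) (x c A : R) :
  {within `[0, 1], continuous f} ->
  (forall t, 0 < t < 1 -> `|f t - f x - c * (t - x)| <= A * (t - x) ^+ 2) ->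
  forall t, 0 <= t <= 1 -> `|f t - f x - c * (t - x)| <= A * (t - x) ^+ 2.
Proof.
move=> cf H t t01; rewrite -subr_ge0.
apply: (@le_within01 _ (fun t => A * (t - x) ^+ 2 - `|f t - f x - c * (t - x)|)) => //.
  have cx : {within `[0, 1], continuous (fun t : R => t - x)}.
    apply: continuous_subspaceT => u.
    by apply: cvgB; [exact: cvg_id|exact: cvg_cst].
  move=> u; apply: cvgB.
    apply: cvgM; first exact: cvg_cst.
    by apply: cvgM; exact: cx.
  apply: cvg_norm; apply: cvgB; last by apply: cvgM; [exact: cvg_cst|exact: cx].
  by apply: cvgB; [exact: cf|exact: cvg_cst].
by move=> u /H; rewrite subr_ge0.
Qed.

Lemma binomial_mean_at0 (R : realType) n (a : nat -> R) :
  binomial_mean n a 0 = a 0%N.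
Proof.
elim: n => [|n IH]; last by rewrite binomial_meanS IH mul0r subr0 add0r mul1r.
by rewrite /binomial_mean big_ord_recl big_ord0 bin0 subr0 !expr0 !mulr1 addr0.
Qed.

Lemma binomial_mean_at1 (R : realType) n (a : nat -> R) :
  binomial_mean n a 1 = a n.
Proof.
elim: n a => [|n IH] a; last by rewrite binomial_meanS !IH subrr mul0r addr0 mul1r.
by rewrite /binomial_mean big_ord_recl big_ord0 bin0 subrr !expr0 !mulr1 addr0.
Qed.

(** At 0 and 1 the operator interpolates [f]. Elsewhere [f] lies between two parabolas touching it
    at [x]; they enclose it on all of [0, 1], so the quartic coefficient is 0. *)
Lemma bernstein_taylor (R : realType) (M : R) (f : R -> R) :  0 <= M ->
  (forall x, 0 < x < 1 -> exists c, forall t, 0 <= t <= 1 ->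
     `|f t - f x - c * (t - x)| <= M / (x * (1 - x)) * (t - x) ^+ 2) ->
  forall n x, (0 < n)%N -> 0 <= x <= 1 -> `|bernstein n f x - f x| <= M / n%:R.
Proof.
move=> M0 H n x n0 x01; have nn0 : n%:R != 0 :> R by rewrite pnatr_eq0 -lt0n.
have [->|x0] := eqVneq x 0.
  by rewrite /bernstein binomial_mean_at0 mul0r subrr normr0 divr_ge0.
have [->|x1] := eqVneq x 1.
  by rewrite /bernstein binomial_mean_at1 divff// subrr normr0 divr_ge0.
have x01' : 0 < x < 1 by rewrite !lt_neqAle eq_sym x0 x1.
have /andP[{}x0 {}x1] := x01'.
have [c hc] := H x x01'.
have E : M / (x * (1 - x)) * (x * (1 - x)) = M.
  by rewrite divfK// mulf_neq0 ?subr_eq0 ?gt_eqF.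
have h1 := @bernstein_touch _ n f c (M / (x * (1 - x))) 0 x n0 x01 (lexx _).
have h2 := @bernstein_touch _ n (\- f) (- c) (M / (x * (1 - x))) 0 x n0 x01 (lexx _).
rewrite E mul0r addr0 in h1; rewrite E mul0r addr0 bernsteinN in h2.
rewrite ler_norml; apply/andP; split.
  rewrite lerNl opprD; apply: h2 => t /hc /=.
  by rewrite ler_norml; lra.
by apply: h1 => t /hc; rewrite ler_norml; lra.
Qed.

(** * Absolute continuity up to the end points *)

(** Monotonicity of Lebesgue measure. Empty intervals are allowed because truncation at a level
    produces them. *)
Lemma sum_disjoint_itv (R : realType) n (u v : 'I_n -> R) (a b : R) : a <= b ->
  (forall i, [/\ a <= u i, u i <= v i & v i <= b]) ->
  trivIset [set: 'I_n] (fun i => `]u i, v i[%classic) ->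
  \sum_(i < n) (v i - u i) <= b - a.
Proof.
move=> ab uv tuv; rewrite -lee_fin -sumEFin.
have mI i : measurable (`]u i, v i[%classic : set (measurableTypeR R)).
  exact: measurable_itv.
have E : (lebesgue_measure (`[a, b]%classic : set R) = (b - a)%:E)%E.
  rewrite lebesgue_measure_itv/= lte_fin; case: ltP => [//|ba].
  by rewrite (_ : b = a) ?subrr//; apply/eqP; rewrite eq_le ba ab.
rewrite -E; apply: (@le_trans _ _
    (lebesgue_measure (\big[setU/set0]_(i < n | xpredT i) `]u i, v i[%classic)%E)).
  rewrite [leRHS](@measure_bigsetU_ord _ _ _ lebesgue_measure n xpredT _ mI tuv).
  apply: lee_sum => i _; have [_ ui _] := uv i.
  rewrite [leRHS]lebesgue_measure_itv/= lte_fin; case: ltP => // vu.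
  by rewrite lee_fin subr_le0.
apply: le_measure; rewrite ?inE.
- by apply: bigsetU_measurable.
- exact: measurable_itv.
apply: (big_ind (fun A => A `<=` `[a, b])) => [//|A B hA hB x []|i _ x /=].
- exact: hA.
- exact: hB.
rewrite !in_itv/= => /andP[h1 h2].
by have [h3 _ h4] := uv i; rewrite (le_trans h3 (ltW h1)) (le_trans (ltW h2) h4).
Qed.

Lemma sqrt_AC (R : realType) : absolutely_continuous 0 1 (@Num.sqrt R).
Proof.
(* The part below the level contributes at most r and the rest less than (r^2 / 2) / r = r / 2, in
   total less than e = 2 r. *)
move=> e e0; pose r := e / 2; have r0 : 0 < r by rewrite divr_gt0.
exists (r ^+ 2 / 2); first by rewrite divr_gt0// exprn_gt0.
move=> n u v uv tuv uvd.
have sq i : [/\ 0 <= Num.sqrt (u i), Num.sqrt (u i) < Num.sqrt (v i),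
    Num.sqrt (u i) ^+ 2 = u i & Num.sqrt (v i) ^+ 2 = v i].
  have [u0 uvi _] := uv i; split; rewrite ?sqrtr_ge0//.
  - by rewrite ltr_sqrt// (le_lt_trans u0).
  - by rewrite sqr_sqrtr.
  - by rewrite sqr_sqrtr// (le_trans u0)// ltW.
(* Below the level r the increments of sqrt telescope to at most r; above it
   sqrt is Lipschitz with constant 1/r. *)
pose z i := Num.min (Num.sqrt (u i)) r; pose w i := Num.min (Num.sqrt (v i)) r.
have zw : \sum_(i < n) (w i - z i) <= r - 0.
  apply: sum_disjoint_itv (ltW r0) _ _.
    move=> i; have [h1 h2 _ _] := sq i; rewrite /z /w; split.
    + by rewrite le_min h1 ltW.
    + by rewrite le_min !ge_min (ltW h2) lexx ?orbT.
    + by rewrite ge_min lexx orbT.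
  move=> i j _ _ [x []]; rewrite /= !in_itv/= => /andP[h1 h2] /andP[h3 h4].
  apply: tuv => //; exists (x ^+ 2).
  have xr : x < r by move: h2; rewrite lt_min => /andP[].
  have h k : z k < x -> x < w k -> `]u k, v k[%classic (x ^+ 2).
    have [k1 k2 <- <-] := sq k; rewrite /z /w gt_min => /orP[k3|]; last by lra.
    rewrite lt_min => /andP[k4 _].
    by rewrite /= in_itv/= !ltr_pXn2r ?nnegrE//; lra.
  by split; exact: h.
(* If the root of [v i] is at least r, then v - u is at least r times the difference of the roots;
   otherwise that difference is w - z. *)
have term i : `|Num.sqrt (v i) - Num.sqrt (u i)| <= (w i - z i) + (v i - u i) / r.
  have [k1 k2 k3 k4] := sq i; rewrite gtr0_norm ?subr_gt0// -{2}k3 -{2}k4 /w /z.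
  set s := Num.sqrt (v i) in k2 k4 *; set t := Num.sqrt (u i) in k1 k2 k3 *.
  rewrite -lerBlDl ler_pdivlMr//.
  rewrite /Order.min; case: ltP => h1; case: ltP => h2; nra.
apply: le_lt_trans (_ : r + \sum_(i < n) (v i - u i) / r < e).
  apply: le_trans (ler_sum _ (fun i _ => term i)) _.
  by rewrite big_split/= lerD2r -[leRHS]subr0.
have : (\sum_(i < n) (v i - u i)) / r < r / 2.
  by rewrite ltr_pdivrMr// mulrAC -expr2.
rewrite mulr_suml /r; lra.
Qed.

Lemma sqrt1B_AC (R : realType) :
  absolutely_continuous 0 1 (fun t : R => Num.sqrt (1 - t)).
Proof.
move=> e /sqrt_AC[d d0 h]; exists d => // n u v uv tuv uvd.
under eq_bigr do rewrite distrC.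
apply: (h n (fun i => 1 - v i) (fun i => 1 - u i)).
- by move=> i; have [h1 h2 h3] := uv i; split; lra.
- move=> i j _ _ [x []]; rewrite /= !in_itv/= => h1 h2.
  by apply: tuv => //; exists (1 - x); split; rewrite /= in_itv/=; lra.
- apply: le_lt_trans uvd; apply: ler_sum => i _; lra.
Qed.

(** ln s <= s - 1 at s = 1/sqrt x. The logarithm is thus replaced by a function whose antiderivative
    is absolutely continuous on [0, 1]. *)
Lemma ln_le_sqrt (R : realType) (x : R) : 0 < x -> - ln x <= 2 / Num.sqrt x.
Proof.
move=> x0; have s0 : 0 < Num.sqrt x by rewrite sqrtr_gt0.
have := ln_le_subr1 (_ : 0 < (Num.sqrt x)^-1); rewrite invr_gt0 => /(_ s0).
have -> : ln x = 2 * ln (Num.sqrt x).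
  by rewrite -{1}(sqr_sqrtr (ltW x0)) lnXn// mulr_natl.
rewrite lnV ?posrE//; lra.
Qed.

Lemma logit_le_sqrt (R : realType) (x : R) : 0 < x < 1 ->
  `|logit x| <= 2 / Num.sqrt x + 2 / Num.sqrt (1 - x).
Proof.
move=> /andP[x0 x1]; have x10 : 0 < 1 - x by rewrite subr_gt0.
have h1 := ln_le_sqrt x0; have h2 := ln_le_sqrt x10.
have h3 : ln x <= 0 by rewrite ln_le0// ltW.
have h4 : ln (1 - x) <= 0 by rewrite ln_le0// gerBl ltW.
have h5 : 0 <= 2 / Num.sqrt x by rewrite divr_ge0 ?sqrtr_ge0.
have h6 : 0 <= 2 / Num.sqrt (1 - x) by rewrite divr_ge0 ?sqrtr_ge0.
by rewrite /logit ler_norml; apply/andP; split; lra.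
Qed.

(** Comparison with the point 1/2, where logit vanishes, bounds |f'| by a function with the explicit
    antiderivative [P]. The increments of [P] dominate those of [f], and [P] is absolutely
    continuous up to the end points. *)
Lemma AC01_of_logit_dist (R : realType) (M : R) (f : R -> R) : 0 <= M ->
  {within `[0, 1], continuous f} ->
  (forall x : R, 0 < x < 1 -> derivable f x 1) ->
  (forall x y, 0 < x -> x <= y -> y < 1 ->
     `|derive1 f y - derive1 f x| <= M * (logit y - logit x)) ->
  absolutely_continuous 0 1 f.
Proof.
move=> M0 cf df H; pose c := `|derive1 f 2^-1|.
have l2 : logit (2^-1 : R) = 0.
  by rewrite /logit (_ : 1 - 2^-1 = 2^-1) ?subrr//; lra.
have fb (x : R) : 0 < x < 1 -> `|derive1 f x| <=
    c + M * (2 / Num.sqrt x + 2 / Num.sqrt (1 - x)).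
  move=> /[dup] x01 /andP[x0 x1].
  rewrite -[derive1 f x](subrK (derive1 f 2^-1)) addrC.
  apply: le_trans (ler_normD _ _) _; rewrite lerD2l.
  apply: le_trans (ler_wpM2l M0 (logit_le_sqrt x01)).
  have [x2|x2] := leP 2^-1 x.
    apply: le_trans (H _ _ _ x2 x1) _; first lra.
    by rewrite l2 subr0 ler_wpM2l// ler_norm.
  rewrite distrC; apply: le_trans (H _ _ x0 (ltW x2) _) _; first lra.
  by rewrite l2 sub0r ler_wpM2l// -normrN ler_norm.
pose P x := c * x + 4 * M * Num.sqrt x + (- (4 * M)) * Num.sqrt (1 - x).
have PAC : absolutely_continuous 0 1 P.
  apply: absolutely_continuousD; first apply: absolutely_continuousD.
  - apply: absolutely_continuousZ; apply: (@absolutely_continuous_lipschitz _ _ _ 1).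
    by move=> x y _ xy _; rewrite mul1r gtr0_norm// subr_gt0.
  - by apply: absolutely_continuousZ; exact: sqrt_AC.
  - by apply: absolutely_continuousZ; exact: sqrt1B_AC.
have cP : continuous P.
  move=> x; apply: cvgD; first apply: cvgD.
  - by apply: cvgM; [exact: cvg_cst|exact: cvg_id].
  - by apply: cvgM; [exact: cvg_cst|exact: sqrt_continuous].
  - apply: cvgM; first exact: cvg_cst.
    apply: (@continuous_comp _ _ _ (fun x : R => 1 - x) Num.sqrt).
      by apply: cvgB; [exact: cvg_cst|exact: cvg_id].
    exact: sqrt_continuous.
apply: absolutely_continuous_le PAC => u v u0 uv v1.
have K (s : R) : `|s| <= 1 -> s * (f v - f u) <= P v - P u.
  move=> s1; pose D x := P x - s * f x.
  pose d x := c + M * (2 / Num.sqrt x + 2 / Num.sqrt (1 - x)) - s * derive1 f x.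
  have [| |t] := @MVT _ D d u v uv.
  + move=> x; rewrite in_itv/= => xuv; have x01 : 0 < x < 1 by lra.
    have /andP[x0 x1] := x01; have x10 : 0 < 1 - x by rewrite subr_gt0.
    have d1 : is_derive x 1 f (derive1 f x).
      by rewrite derive1E; apply: DeriveDef => //; exact: df.
    have d2 := is_derive1_sqrt x0.
    have d3 : is_derive x 1 (fun y => Num.sqrt (1 - y)) ((2 * Num.sqrt (1 - x))^-1 * (0 - 1)).
      apply: (@is_derive1_comp R (@Num.sqrt R) (fun y => 1 - y)).
      exact: is_derive1_sqrt.
    rewrite /D /P; apply: is_derive_eq; rewrite /GRing.scale/= /d.
    by field; rewrite !gt_eqF ?sqrtr_gt0.
  + move=> x; apply: cvgB; first exact: (continuous_subspaceT cP).
    apply: cvgM; first exact: cvg_cst.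
    move: x; apply: continuous_subspaceW cf => x /=; rewrite !in_itv/=; lra.
  rewrite in_itv/= => tuv E.
  suff : 0 <= D v - D u by rewrite /D; lra.
  rewrite E mulr_ge0 ?subr_ge0 ?(ltW uv)// /d.
  rewrite (le_trans (ler_norm _))// normrM.
  have t01 : 0 < t < 1 by lra.
  by apply: le_trans (fb t t01); rewrite ler_piMl.
have := K 1; rewrite normr1 => /(_ (lexx _)) h1.
have := K (- 1); rewrite normrN1 => /(_ (lexx _)) h2.
apply: le_trans (ler_norm (P v - P u)).
by rewrite ler_norml; lra.
Qed.

(** * Essential boundedness and measurability of derivatives *)

Lemma Linfty01_bounded (R : realType) (g : R -> R) : Linfty01 g ->
  exists2 M : R, 0 <= M &
    {ae (@lebesgue_measure R), forall x, 0 <= x <= 1 -> `|g x| <= M}.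
Proof.
move=> [h hL gh]; have flt := ae_filter_ringOfSetsType (@lebesgue_measure R).
have hfin : finite_norm (@lebesgue_measure R) +oo h.
  by have := sub_Lfun_finLfun hL; rewrite inE.
move: hfin; rewrite /finite_norm unlock.
(* The norm of exponent +oo is the essential supremum only on a space of positive measure. *)
have -> : (0 < lebesgue_measure [set: R])%E.
  apply: (@lt_le_trans _ _ (lebesgue_measure (`[0, 1]%classic : set R))).
    by rewrite lebesgue_measure_itv/= lte_fin ltr01 -EFinB subr0 lte_fin.
  by apply: le_measure; rewrite ?inE//; exact: measurable_itv.
set S := ess_sup _ _ => Soo; exists (`|fine S|); first exact: normr_ge0.
have Sge := ess_sup_ge (@lebesgue_measure R) (abse \o (EFin \o h)).
have := @filterI _ _ flt _ _ gh Sge; apply: filterS.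
move=> x [+ Sx] x01 => ->; last by rewrite /= in_itv.
rewrite -/S /= in Sx; move: Soo Sx; case: S => [s _|//|_ //] /=.
by rewrite lee_fin => /le_trans; apply; exact: ler_norm.
Qed.

(** The steps form a sequence, so that the limit superior of the quotients is measurable. *)
Definition quotient (R : realType) (F : R -> R) (n : nat) (x : R) : R :=
  n.+1%:R * (F (x + n.+1%:R^-1) - F x).

Lemma quotient_cvg (R : realType) (F : R -> R) (x : R) : derivable F x 1 ->
  quotient F n x @[n --> \oo] --> derive1 F x.
Proof.
move=> dF; have : h^-1 *: (F (h *: 1 + x) - F x) @[h --> 0^'] --> derive1 F x.
  by rewrite derive1E; exact: dF.
move=> /cvg_dnbhs_at_right/cvg_at_rightP/(_ harmonic); set G := fun n => _.
have -> : (fun n => quotient F n x) = (fun n =>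
    (harmonic n)^-1 *: (F (harmonic n *: 1 + x) - F x)).
  apply/funext => n; rewrite /quotient /harmonic /= invrK [_ *: 1]mulr1.
  by rewrite [n.+1%:R^-1 + x]addrC.
apply; split; last exact: cvg_harmonic.
by move=> n; rewrite /harmonic/= invr_gt0.
Qed.

(** The interval is exhausted by countably many compact ones; [n.+3] makes even the first of them
    nondegenerate. *)
Lemma ae_derivable01 (R : realType) (F : R -> R) :
  (forall a b : R, 0 < a -> a < b -> b < 1 -> absolutely_continuous a b F) ->
  {ae (@lebesgue_measure R), forall x, 0 < x < 1 -> derivable F x 1}.
Proof.
move=> FAC; have flt := ae_filter_ringOfSetsType (@lebesgue_measure R).
pose r n : R := n.+3%:R^-1.
have r0 n : 0 < r n by rewrite invr_gt0.
have r3 n : r n < 2^-1 by rewrite ltf_pV2 ?posrE// ltr_nat.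
have : {ae (@lebesgue_measure R), forall x, forall n, r n < x < 1 - r n ->
    derivable F x 1}.
  apply: ae_foralln => n; apply: AC_ae_derivable; first by have := r3 n; lra.
  by apply: FAC => //; have := r3 n; have := r0 n; lra.
apply: filterS => x H /andP[x0 x1].
pose m := Num.min x (1 - x).
have m0 : 0 < m by rewrite lt_min x0 subr_gt0.
have [n rn] : exists n, r n < m.
  exists (Num.bound m^-1); rewrite /r -[ltRHS]invrK ltf_pV2 ?posrE ?invr_gt0//.
  apply: lt_le_trans (archi_boundP _) _; first by rewrite invr_ge0 ltW.
  by rewrite ler_nat -addn3 leq_addr.
by apply: (H n); move: rn; rewrite lt_min => /andP[]; lra.
Qed.

(** [derive1 F] is uncontrolled where [F] is not derivable. The limit superior of difference
    quotients is a Borel function that agrees with it wherever the derivative exists, hence almost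
    everywhere. *)
Lemma Linfty01_of_bounded (R : realType) (F : R -> R) (M : R) : 0 <= M ->
  (forall a b : R, 0 < a -> a < b -> b < 1 -> absolutely_continuous a b F) ->
  (forall x, 0 < x < 1 -> {for x, continuous F}) ->
  (forall x : R, 0 < x < 1 -> derivable F x 1 -> `|x * (1 - x) * derive1 F x| <= M) ->
  Linfty01 (fun x => x * (1 - x) * derive1 F x).
Proof.
move=> M0 FAC Fc FM; have flt := ae_filter_ringOfSetsType (@lebesgue_measure R).
have m01 : measurable (`]0, 1[%classic : set R) by exact: measurable_itv.
(* Extension by zero gives a Borel function on the line that coincides with [F] near each point of
   ]0, 1[. *)
pose G := F \_ `]0, 1[.
have mG : measurable_fun [set: R] G.
  apply: (measurable_restrictT _ m01).1; apply: open_continuous_measurable_fun.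
    exact: itv_open.
  by move=> x; rewrite inE /= in_itv/=; exact: Fc.
have mq n : measurable_fun [set: R] (quotient G n).
  apply: measurable_funM => //; apply: measurable_funB => //.
  by apply: measurableT_comp => //; apply: measurable_funD.
pose E x := limn_esup (fun n => (quotient G n x)%:E).
have mE : measurable_fun [set: R] E.
  by apply: measurable_fun_limn_esup => n; apply/measurable_EFinP.
pose h := (fun x => x * (1 - x) * fine (E x)) \_ `]0, 1[.
have mh : measurable_fun [set: R] h.
  apply: (measurable_restrictT _ m01).1; apply: measurable_funTS.
  apply: measurable_funM; first by apply: measurable_funM => //; exact: measurable_funB.
  by apply: measurableT_comp mE; exact: fine_measurable.
have hE x : 0 < x < 1 -> derivable F x 1 -> h x = x * (1 - x) * derive1 F x.
  move=> x01 dF; rewrite /h patchE mem_set ?in_itv//=; congr (_ * _).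
  have GF : \near x, F x = G x.
    have := near_itv x01; apply: filterS => y y01.
    by rewrite /G patchE mem_set//= in_itv.
  have dG : derivable G x 1 by exact: near_eq_derivable dF.
  rewrite (near_eq_derive1 GF) /E.
  have c : (quotient G n x)%:E @[n --> \oo] --> (derive1 G x)%:E.
    by apply: cvg_EFin; [exact: nearW|exact: quotient_cvg].
  by rewrite (cvg_limn_einf_sup c).2.
have ad := ae_derivable01 FAC.
exists h.
  apply/andP; split; rewrite inE//=.
  rewrite /finite_norm unlock; case: ifP => // _.
  apply: (@le_lt_trans _ _ M%:E); last exact: ltry.
  apply/ess_supP; move: ad; apply: filterS => x dx /=; rewrite lee_fin.
  have [x01|x01] := boolP (0 < x < 1); first by rewrite hE ?FM//; exact: dx.
  rewrite /h patchE memNset ?normr0//= in_itv; exact/negP.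
have := @filterI _ _ flt _ _ ad (@filterI _ _ flt _ _ (ae_neq 0) (ae_neq 1)).
apply: filterS => x [dx [x0 x1]]; rewrite /= in_itv/= => /andP[h0 h1].
have x01 : 0 < x < 1 by rewrite !lt_neqAle h0 h1 x1 eq_sym x0.
by rewrite hE//; exact: dx.
Qed.

(** * Saturation *)

Lemma continuous01_bounded (R : realType) (f : R -> R) :
  {within `[0, 1], continuous f} ->
  exists B : R, forall t, 0 <= t <= 1 -> `|f t| <= B.
Proof.
move=> cf; have [c _ hc] := EVT_max ler01 cf; have [d _ hd] := EVT_min ler01 cf.
exists (Num.max (f c) (- f d)) => t t01.
have h1 := hc t; have h2 := hd t; rewrite in_itv/= t01 in h1 h2.
by rewrite ler_norml lerNl !le_max lerN2 h1// h2// orbT.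
Qed.

(** A real [sup] is an upper bound only of a set known to be bounded, so some [B] has to be
    supplied. *)
Lemma le_supnorm (R : realType) (g : R -> R) (B : R) :
  (forall x, 0 <= x <= 1 -> `|g x| <= B) ->
  forall x, 0 <= x <= 1 -> `|g x| <= supnorm g.
Proof.
move=> gB x x01; apply: ub_le_sup; last by exists x => //=; rewrite in_itv.
by exists B => _ [y + <-]; rewrite /= in_itv/=; exact: gB.
Qed.

Lemma supnorm_le (R : realType) (g : R -> R) (B : R) :
  (forall x, 0 <= x <= 1 -> `|g x| <= B) -> supnorm g <= B.
Proof.
move=> gB; apply: ge_sup.
  by exists `|g 0|; exists 0 => //=; rewrite in_itv/= lexx ler01.
by move=> _ [y + <-]; rewrite /= in_itv/=; exact: gB.
Qed.

Lemma rounded_bernstein_bounded (R : realType) (r : R -> int) n (f : R -> R) :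
  C01 f -> exists B : R, forall x, 0 <= x <= 1 ->
    `|rounded_bernstein r n f x - f x| <= B.
Proof.
move=> /continuous01_bounded[B fB].
exists (\sum_(k < n.+1) `|(r (f (k%:R / n%:R) * 'C(n, k)%:R))%:~R| + B).
move=> x /[dup] x01 /andP[x0 x1].
apply: le_trans (ler_normB _ _) _; rewrite lerD ?fB//.
apply: le_trans (ler_norm_sum _ _ _) _; apply: ler_sum => k _.
rewrite -mulrA normrM ler_piMr// ger0_norm.
  by rewrite mulr_ile1 ?exprn_ge0 ?exprn_ile1 ?subr_ge0// gerBl.
by rewrite mulr_ge0 ?exprn_ge0 ?subr_ge0.
Qed.

(** The Landau symbol in explicit form; the strict [N < n] also provides n > 0. *)
Lemma approx_error_bigO (R : realType) (r : R -> int) (f : R -> R) : C01 f ->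
  approx_error (rounded_bernstein r) f =O_\oo (fun n => n%:R^-1 : R) ->
  exists2 K : R, 0 <= K & exists N, forall n, (N < n)%N -> forall x, 0 <= x <= 1 ->
    `|rounded_bernstein r n f x - f x| <= K / n%:R.
Proof.
move=> cf /eqOP H.
have [K [K0 [N _ KN]]] : exists K : R, 0 <= K /\
    \forall n \near \oo, `|approx_error (rounded_bernstein r) f n| <= K * `|n%:R^-1|.
  near +oo_R => K; exists K; split; near: K; last exact: H.
  exact: nbhs_pinfty_ge.
exists K => //; exists N => n Nn x x01.
have [B hB] := rounded_bernstein_bounded r n cf.
apply: le_trans (le_supnorm hB x01) _.
apply: le_trans (ler_norm _) _; apply: le_trans (KN n (ltnW Nn)) _.
by rewrite ger0_norm.
Unshelve. all: by end_near. Qed.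

Lemma approx_error_littleo (R : realType) (r : R -> int) (f : R -> R) : C01 f ->
  approx_error (rounded_bernstein r) f =o_\oo (fun n => n%:R^-1 : R) ->
  forall K : R, 0 < K -> exists N, forall n, (N < n)%N -> forall x, 0 <= x <= 1 ->
    `|rounded_bernstein r n f x - f x| <= K / n%:R.
Proof.
move=> cf /eqoP H K /H[N _ KN]; exists N => n Nn x x01.
have [B hB] := rounded_bernstein_bounded r n cf.
apply: le_trans (le_supnorm hB x01) _.
apply: le_trans (ler_norm _) _; apply: le_trans (KN n (ltnW Nn)) _.
by rewrite ger0_norm.
Qed.

Lemma bigO_approx_error (R : realType) (L : nat -> (R -> R) -> R -> R) (f : R -> R) (K : R) :
  (forall n x, (0 < n)%N -> 0 <= x <= 1 -> `|L n f x - f x| <= K / n%:R) ->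
  approx_error L f =O_\oo (fun n => n%:R^-1 : R).
Proof.
move=> H; apply/eqOP; near=> k; near=> n.
have n0 : (0 < n)%N by near: n; exact: nbhs_infty_gt.
have E x : 0 <= x <= 1 -> `|L n f x - f x| <= k / n%:R.
  move=> x01; apply: le_trans (H n x n0 x01) _.
  by rewrite ler_wpM2r ?invr_ge0//; near: k; exact: nbhs_pinfty_ge.
rewrite [X in _ * X]ger0_norm ?invr_ge0// ger0_norm; first exact: supnorm_le.
have h0 : 0 <= (0 : R) <= 1 by rewrite lexx ler01.
exact: le_trans (normr_ge0 _) (le_supnorm E h0).
Unshelve. all: by end_near. Qed.

Lemma rounded_bernstein_rate (R : realType) (r : R -> int) (K : R) N (f : R -> R) :
  (forall a, `|(r a)%:~R - a| <= 1) ->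
  (forall n, (N < n)%N -> forall x, 0 <= x <= 1 ->
    `|rounded_bernstein r n f x - f x| <= K / n%:R) -> bernstein_rate K f.
Proof.
move=> hr H x /[dup] x01 /andP[x0 x1].
have [D D0 hD] := rounded_bernstein_pointwise hr x01.
exists D, N => n Nn; have n0 : (0 < n)%N by exact: leq_ltn_trans Nn.
rewrite -(subrK (rounded_bernstein r n f x) (bernstein n f x)) -addrA addrC.
apply: le_trans (ler_normD _ _) _; rewrite lerD//; last by rewrite distrC hD.
by apply: H => //; rewrite !ltW.
Qed.

Lemma rounded_bernstein0 (R : realType) (r : R -> int) n (f : R -> R) :
  rounded_bernstein r n f 0 = (r (f 0))%:~R.
Proof.
rewrite /rounded_bernstein big_ord_recl big1/= => [|k _].
  by rewrite bin0 mul0r !mulr1 subr0 expr1n !mulr1 addr0.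
by rewrite /bump/= exprS mul0r mulr0 mul0r.
Qed.

Lemma rounded_bernstein1 (R : realType) (r : R -> int) n (f : R -> R) :
  (0 < n)%N -> rounded_bernstein r n f 1 = (r (f 1))%:~R.
Proof.
move=> n0; rewrite /rounded_bernstein big_ord_recr big1/= => [|k _].
  by rewrite binn subnn divff ?pnatr_eq0 -?lt0n// subrr expr1n expr0 !mulr1 add0r.
by rewrite subrr -(subnSK (ltn_ord k)) exprS mul0r mulr0.
Qed.

Lemma eventually_le_eq0 (R : realType) (K c : R) N :
  (forall n, (N < n)%N -> `|c| <= K / n%:R) -> c = 0.
Proof.
move=> H; apply/eqP; apply: contraT => c0; have cp : 0 < `|c| by rewrite normr_gt0.
pose m := Num.bound (`|K| / `|c|); pose n := (N + m).+1.
have : (N < n)%N by rewrite ltnS leq_addr.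
move=> /H; rewrite ler_pdivlMr ?ltr0n// => h.
have : `|K| / `|c| < m%:R by rewrite archi_boundP// divr_ge0.
rewrite ltr_pdivrMr// => h2.
have : m%:R * `|c| <= `|c| * n%:R by rewrite mulrC ler_wpM2l// ler_nat leqW// leq_addl.
have := ler_norm K; lra.
Qed.

(** At 0 and 1 the rounded polynomial has the same value for every n > 0, so an error tending to 0
    vanishes there. *)
Lemma rate_integer_ends (R : realType) (r : R -> int) (K : R) N (f : R -> R) :
  (forall n, (N < n)%N -> forall x, 0 <= x <= 1 ->
    `|rounded_bernstein r n f x - f x| <= K / n%:R) ->
  f 0 \is a Num.int /\ f 1 \is a Num.int.
Proof.
move=> H; have e0 : (r (f 0))%:~R - f 0 = 0.
  apply: (@eventually_le_eq0 _ K _ N) => n /H/(_ 0).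
  by rewrite lexx ler01 rounded_bernstein0; exact.
have e1 : (r (f 1))%:~R - f 1 = 0.
  apply: (@eventually_le_eq0 _ K _ N) => n Nn; have /(_ 1) := H n Nn.
  rewrite lexx ler01 rounded_bernstein1; first exact.
  exact: leq_ltn_trans Nn.
move/subr0_eq: e0 => <-; move/subr0_eq: e1 => <-.
by split; exact: intr_int.
Qed.

Lemma touch_of_rate (R : realType) (K : R) (f : R -> R) : C01 f ->
  bernstein_rate K f -> touch_bound K f /\ touch_bound K (\- f).
Proof.
move=> /continuous01_bounded[B fB] H; split.
  exact: bernstein_rate_touch fB H.
apply: (@bernstein_rate_touch _ K B); last exact: bernstein_rateN.
by move=> t /fB; rewrite normrN.
Qed.

Lemma rounded_bernstein_bigO (R : realType) (r : R -> int) (M : R) (f : R -> R) :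
  rounding r -> f 0 \is a Num.int -> f 1 \is a Num.int ->
  (forall n x, (0 < n)%N -> 0 <= x <= 1 -> `|bernstein n f x - f x| <= M / n%:R) ->
  approx_error (rounded_bernstein r) f =O_\oo (fun n => n%:R^-1 : R).
Proof.
move=> hr f0 f1 H; apply: (@bigO_approx_error _ _ _ (1 + M)) => n x n0 x01.
rewrite -(subrK (bernstein n f x) (rounded_bernstein r n f x)) -addrA.
apply: le_trans (ler_normD _ _) _; rewrite mulrDl mul1r lerD ?H//.
exact: rounded_bernstein_uniform.
Qed.

Lemma AC01_continuous (R : realType) (f : R -> R) :
  absolutely_continuous 0 1 f -> C01 f.
Proof.
move=> /(seqAC_clamp ler01)/seqAC_continuous cf.
apply: (@subspace_eq_continuous _ _ _ (f \o clamp 0 1)).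
  by move=> x; rewrite inE /= in_itv/= => x01; rewrite /= clamp_id.
exact: continuous_subspaceT.
Qed.

(** * The saturation class *)

Lemma phi_sqr (R : realType) (x : R) : 0 <= x <= 1 -> phi x ^+ 2 = x * (1 - x).
Proof. by move=> /andP[x0 x1]; rewrite sqr_sqrtr// mulr_ge0// subr_ge0. Qed.

(** The class of the theorem, named because it is the same for every rounding. *)
Definition bernstein_saturation_class (R : realType) : set (R -> R) :=
  [set f : R -> R | [/\ AC01 f,
                 f 0 \is a Num.int /\ f 1 \is a Num.int,
                 forall x : R, 0 < x < 1 -> derivable f x 1,
                 ACloc01 (derive1 f)
               & Linfty01 (fun x => phi x ^+ 2 * derive1 (derive1 f) x)]].

Lemma saturation_class_sub (R : realType) (r : R -> int) (f : R -> R) :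
  rounding r ->
  saturation_class (rounded_bernstein r) (fun n => n%:R^-1) f ->
  bernstein_saturation_class f.
Proof.
move=> [hr rint] [cf /(approx_error_bigO cf)[K K0 [N KN]]].
have [t1 t2] := touch_of_rate cf (rounded_bernstein_rate hr KN).
have [df fL d2f] := bernstein_rate_regular K0 t1 t2 cf.
have fAC : forall a b : R, 0 < a -> a < b -> b < 1 ->
    absolutely_continuous a b (derive1 f).
  move=> a b a0 ab b1; have [L L0 hL] := fL a b a0 ab b1.
  apply: (@absolutely_continuous_lipschitz _ _ _ L) => x y ax xy yb.
  rewrite -[y - x]gtr0_norm ?subr_gt0// hL// ?ax ?yb ?(le_trans ax (ltW xy))//.
  by rewrite (le_trans (ltW xy) yb).
have M0 : 0 <= 2 * (K + 1) by rewrite mulr_ge0// addr_ge0.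
(* Continuity of f', from its local Lipschitz bound, is what makes a Borel representative of f''
   available. *)
have f'c (x : R) : 0 < x < 1 -> {for x, continuous (derive1 f)}.
  move=> /andP[x0 x1].
  have [|||L L0 hL] := fL (x / 2) ((1 + x) / 2); [lra|lra|lra|].
  have xx : x / 2 <= x <= (1 + x) / 2 by lra.
  have L1 : 0 < L + 1 by rewrite ltr_wpDl.
  apply/cvgrPdist_lt => e e0; near=> y.
  have yy : x / 2 < y < (1 + x) / 2.
    by near: y; apply: near_itv; lra.
  apply: le_lt_trans (hL y x _ xx) _; first lra.
  apply: (@le_lt_trans _ _ ((L + 1) * `|x - y|)).
    by rewrite ler_wpM2r// lerDl.
  rewrite mulrC -ltr_pdivlMr//; near: y.
  by apply: (filterS _ (nbhsx_ballx x (e / (L + 1)) (divr_gt0 e0 L1))) => y.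
have ld := logit_dist fAC (_ : {ae (@lebesgue_measure R), forall x, 0 < x < 1 ->
  derivable (derive1 f) x 1 -> `|x * (1 - x) * derive1 (derive1 f) x| <= 2 * (K + 1)}).
split=> //.
- apply: (AC01_of_logit_dist M0 cf df); apply: ld.
  by apply: aeW => x x01 dx; exact: d2f.
- exact: rate_integer_ends KN.
(* The weights phi^2 and x(1 - x) agree on [0, 1] only, which is where the equality almost
   everywhere is required. *)
- have [h hL hE] := Linfty01_of_bounded M0 fAC f'c d2f; exists h => //.
  move: hE; apply: (@filterS _ _ (ae_filter_ringOfSetsType (@lebesgue_measure R))).
  move=> x hx /[dup] x01; rewrite /= in_itv/= => x01'.
  by rewrite phi_sqr// hx.
Unshelve. all: by end_near. Qed.

Lemma taylor_bernstein_rate (R : realType) (f : R -> R) :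
  bernstein_saturation_class f -> exists M : R,
  forall n x, (0 < n)%N -> 0 <= x <= 1 -> `|bernstein n f x - f x| <= M / n%:R.
Proof.
move=> [fAC _ df f'AC /Linfty01_bounded[M M0 hM]]; exists M.
have cf := AC01_continuous fAC.
have ld := @logit_dist _ M (derive1 f) f'AC.
apply: bernstein_taylor => // x x01; exists (derive1 f x).
apply: taylor_closed => // t t01; rewrite mulrAC.
apply: taylor_of_logit_dist => //; apply: ld.
move: hM; apply: (@filterS _ _ (ae_filter_ringOfSetsType (@lebesgue_measure R))).
move=> y hy /andP[y0 y1] _; have y01 : 0 <= y <= 1 by rewrite !ltW.
by have := hy y01; rewrite phi_sqr.
Qed.

Lemma saturation_classE (R : realType) (r : R -> int) : rounding r ->
  saturation_class (rounded_bernstein r) (fun n => n%:R^-1) =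
  @bernstein_saturation_class R.
Proof.
move=> hr; apply/seteqP; split => f; first exact: saturation_class_sub.
move=> fK; have [M hM] := taylor_bernstein_rate fK.
have [fAC [f0 f1] _ _ _] := fK; split; first exact: AC01_continuous.
exact: (rounded_bernstein_bigO hr f0 f1 hM).
Qed.

(** * The trivial class and the saturation rate *)

(** (k / n) C(n, k) = C(n - 1, k - 1) for k > 0, so rounding does not change the coefficients of an
    affine function with integer end values. *)
Lemma affine_node_integer (R : realType) (f : R -> R) n k :
  f 0 \is a Num.int -> f 1 \is a Num.int ->
  (forall w, 0 <= w <= 1 -> f w = f 0 + (f 1 - f 0) * w) ->
  (0 < n)%N -> (k <= n)%N -> f (k%:R / n%:R) * 'C(n, k)%:R \is a Num.int.
Proof.
move=> f0 f1 fw n0 kn; rewrite fw ?node_in01// mulrDl -mulrA.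
apply: rpredD; first by rewrite rpredM//; exact: intr_nat.
apply: rpredM; first exact: rpredB.
have nn0 : n%:R != 0 :> R by rewrite pnatr_eq0 -lt0n.
case: k kn => [|k] kn; first by rewrite !mul0r rpred0.
case: n n0 nn0 kn => [//|n] n0 nn0 kn.
rewrite mulrAC -natrM -mul_bin_diag natrM/= mulrAC divff// mul1r.
exact: intr_nat.
Qed.

Lemma rounded_bernstein_affine (R : realType) (r : R -> int) (f : R -> R) :
  rounding r -> C01 f -> f 0 \is a Num.int -> f 1 \is a Num.int ->
  (forall w, 0 <= w <= 1 -> f w = f 0 + (f 1 - f 0) * w) ->
  trivial_class (rounded_bernstein r) f.
Proof.
move=> [hr rint] cf f0 f1 fw; split => // n n0 x; rewrite in_itv/= => x01.
transitivity (bernstein n f x).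
  apply: eq_bigr => k _; congr (_ * _ * _).
  have kn : (k <= n)%N by rewrite -ltnS.
  by have /intrP[z ->] := affine_node_integer f0 f1 fw n0 kn; rewrite rint.
(* Affine functions are reproduced: this is the Taylor estimate with M = 0. *)
apply/eqP; rewrite -subr_eq0 -normr_le0 -(mul0r n%:R^-1).
apply: bernstein_taylor => // {x01 x} x /andP[x0 x1]; exists (f 1 - f 0) => t t01.
rewrite fw// (fw x) ?(ltW x0) ?(ltW x1)// !mul0r.
by rewrite normr_le0; apply/eqP; ring.
Qed.

Lemma rounded_bernstein_littleo (R : realType) (r : R -> int) (f : R -> R) :
  rounding r -> C01 f ->
  approx_error (rounded_bernstein r) f =o_\oo (fun n => n%:R^-1 : R) ->
  trivial_class (rounded_bernstein r) f.
Proof.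
move=> hr cf /(approx_error_littleo cf) H.
have [N hN] := H 1 ltr01; have [f0 f1] := rate_integer_ends hN.
(* The rate o(1/n) gives the touching bound for every K > 0; the bound passes to the limit K = 0. *)
have tb (g : R -> R) : (forall K, 0 < K -> touch_bound K g) -> touch_bound 0 g.
  move=> tg x a b d x01 d0 ht; rewrite oppr0; apply/ler_addgt0Pr => K K0.
  by have := tg K K0 x a b d x01 d0 ht; lra.
have tK K : 0 < K -> touch_bound K f /\ touch_bound K (\- f).
  move=> /H[n hn]; apply: touch_of_rate => //.
  exact: rounded_bernstein_rate hr.1 hn.
apply: rounded_bernstein_affine => //; apply: touch0_affine => //.
  by apply: tb => K /tK[].
by apply: tb => K /tK[].
Qed.

Lemma rounded_bernstein_saturated (R : realType) (r : R -> int) : rounding r ->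
  saturated (rounded_bernstein r) (fun n => n%:R^-1).
Proof.
move=> hr; split=> [f|]; first exact: rounded_bernstein_littleo.
(* The square has integer end values, and its unrounded error is exactly x(1 - x)/n. *)
pose f (x : R) := x ^+ 2; exists f.
have f0 : f 0 \is a Num.int by rewrite /f expr0n rpred0.
have f1 : f 1 \is a Num.int by rewrite /f expr1n rpred1.
split.
- apply: continuous_subspaceT; exact: exprn_continuous.
(* For n = 1 the nodes are 0 and 1 and the operator yields x, which differs from x^2 at 1/2. *)
- move=> [_ /(_ 1%N isT 2^-1)]; rewrite in_itv/= => /(_ _)/wrap[]; first lra.
  rewrite /rounded_bernstein !big_ord_recl big_ord0/= /bump/= mul0r divr1.
  have [_ rint] := hr; rewrite /f expr0n/= expr1n bin0 bin1 mul0r mulr1.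
  have -> : r 0 = 0 by exact: (rint 0).
  have -> : r (1 * 1) = 1 by rewrite mulr1; exact: (rint 1).
  rewrite addn0 subn0 subnn !expr1 expr0; lra.
- apply: (@rounded_bernstein_bigO _ _ 1 _ hr f0 f1).
  apply: bernstein_taylor => // x /andP[x0 x1]; exists (2 * x) => t t01.
  have -> : f t - f x - 2 * x * (t - x) = (t - x) ^+ 2 by rewrite /f; ring.
  rewrite ger0_norm ?sqr_ge0// ler_peMl ?sqr_ge0//.
  have p0 : 0 < x * (1 - x) by rewrite mulr_gt0// subr_gt0.
  rewrite ler_pdivlMr// mul1r; nra.
Qed.

Theorem corollary1p5 (R : realType) (nint : R -> int)
    (hnint : nearest_integer nint) :
  let rate : nat -> R := fun n => n%:R^-1 in
  let K : set (R -> R) :=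
    [set f : R -> R | [/\ AC01 f,
                 f 0 \is a Num.int /\ f 1 \is a Num.int,
                 forall x : R, 0 < x < 1 -> derivable f x 1,
                 ACloc01 (derive1 f)
               & Linfty01 (fun x => phi x ^+ 2 * derive1 (derive1 f) x)]] in
  [/\ saturated (@bernstein_floor R) rate,
      saturated (rounded_bernstein nint) rate,
      saturation_class (@bernstein_floor R) rate = K
    & saturation_class (rounded_bernstein nint) rate = K].
Proof.
have rn := rounding_nearest hnint; have rf := @rounding_floor R.
move=> rate K; split.
- exact: rounded_bernstein_saturated.
- exact: rounded_bernstein_saturated.
- exact: saturation_classE.
- exact: saturation_classE.
Qed.
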